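(* Let $a,b,c,d$ be positive integers with $a+b=c+d$. There exists a Borel set $E\subset[0,1]$ with $\dim_{\mathbb F}(E)=\frac12$ that contains no nontrivial solution of the equation $ax_1+bx_2=cy_1+dy_2$; that is, every $(x_1,x_2,y_1,y_2)\in E^4$ with $ax_1+bx_2=cy_1+dy_2$ is a trivial solution.
   Context: Fourier dimension: for a Borel set $E\subset\mathbb R$, $\dim_{\mathbb F}(E)$ is the supremum of all $\beta\in[0,1]$ for which there exist a Borel probability measure $\mu$ supported on $E$ and a constant $C\in(0,\infty)$ such that $|\hat\mu(\xi)|\le C(1+|\xi|)^{-\beta/2}$ for all $\xi\in\mathbb R$, where $\hat\mu(\xi)=\int e^{-2\pi i x\xi}\,d\mu(x)$. Genus: let $a,b,c,d$ be positive integers with $a+b=c+d$. The equation $ax_1+bx_2=cy_1+dy_2$, written $ax_1+bx_2+(-c)y_1+(-d)y_2=0$, is of genus one if no nonempty proper subcollection of the four coefficients $a,b,-c,-d$ (counted with multiplicity) sums to $0$; otherwise it is of genus two, in which case $\{a,b\}=\{c,d\}$ as multisets. Trivial solutions: for an equation of genus one, a solution is trivial if $x_1=x_2=y_1=y_2$. For an equation of genus two, a solution is trivial if the variables on the two sides are equal in pairs with equal coefficients, i.e. if ($a=c$, $b=d$, $x_1=y_1$ and $x_2=y_2$) or ($a=d$, $b=c$, $x_1=y_2$ and $x_2=y_1$). All other solutions are nontrivial. *)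

(* Defs.v *)
From HB Require Import structures.
From mathcomp Require Import all_boot all_order all_algebra.
From mathcomp Require Import all_classical all_reals all_analysis.
From mathcomp Require Import complex.

Set Implicit Arguments.
Unset Strict Implicit.
Unset Printing Implicit Defensive.

Import Order.TTheory GRing.Theory Num.Theory.
Local Open Scope classical_set_scope.
Local Open Scope ring_scope.

(* exp (i t) *)
Definition expi (R : realType) (t : R) : R[i] := (cos t +i* sin t)%C.

(* Integral of a complex function, componentwise since the library
   integrates only (extended) real functions. *)
Definition cintegral d (T : measurableType d) (R : realType)
    (mu : {measure set T -> \bar R}) (D : set T) (f : T -> R[i]) : R[i] :=
  (Rintegral mu D (fun x => complex.Re (f x))
     +i* Rintegral mu D (fun x => complex.Im (f x)))%C.

Definition fourier_transform (R : realType)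
    (mu : probability (measurableTypeR R) R) (xi : R) : R[i] :=
  cintegral mu setT (fun x : R => expi (- (2 * pi * x * xi))).

(* [E] carries [mu] when [mu E = 1]; for closed [E] this is the same as the
   topological support of [mu] being contained in [E]. [normc] is the
   real-valued complex modulus. *)
Definition fourier_decay (R : realType) (E : set (measurableTypeR R))
    (beta : R) : Prop :=
  exists mu : probability (measurableTypeR R) R,
    mu E = 1%E /\
    exists C : R, 0 < C /\
      forall xi : R,
        ComplexField.Normc.normc (fourier_transform mu xi) <=
          C * (1 + `|xi|) `^ (- (beta / 2)).

(* The set is bounded by 1 and contains 0 as soon as [E] is nonempty; for
   empty [E] the convention [sup set0 = 0] gives dimension 0. *)
Definition fourier_dim (R : realType) (E : set (measurableTypeR R)) : R :=
  sup [set beta : R | 0 <= beta <= 1 /\ fourier_decay E beta].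

(* The coefficients of a x1 + b x2 - c y1 - d y2 = 0; indexing by ['I_4] makes
   subcollections count multiplicity. *)
Definition eqn_coef (a b c d : nat) : 4.-tuple int :=
  [tuple a%:Z; b%:Z; - c%:Z; - d%:Z].

Definition genus_one (a b c d : nat) : bool :=
  [forall S : {set 'I_4},
     (S != finset.set0) && (S != [set: 'I_4]%SET) ==>
       (\sum_(i in S) tnth (eqn_coef a b c d) i != 0)].

Definition trivial_solution (R : realType) (a b c d : nat)
    (x1 x2 y1 y2 : R) : Prop :=
  if genus_one a b c d then [/\ x1 = x2, x2 = y1 & y1 = y2]
  else [/\ a = c, b = d, x1 = y1 & x2 = y2] \/
       [/\ a = d, b = c, x1 = y2 & x2 = y1].

(* Main.v *)
Require Import Defs.
From mathcomp Require Import all_boot all_order all_algebra.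
From mathcomp Require Import all_classical all_reals all_analysis.
From mathcomp Require Import measurable_realfun complex ring lra zify.

(** The set is a Kaufman-type intersection of neighbourhoods of rationals with prime
denominators, arranged as a tower of intervals. An interval of length [l] of the
tower receives its own set [Q] of about [W] primes in [(W, Y]], where [Y] is only
slightly larger than [W], and it is replaced by the intervals of length
[1 / (M * Y ^ 4)] around the fractions [p / q] it contains, [q] in [Q].

No solutions: distinct points of the set eventually lie in different intervals,
hence have different denominators at the next stage. A relation with
coefficients [e i] between at most four points is thus nearly a relation between
fractions with prime denominators at most [Y]; multiplying by the product
of these primes gives an integer of absolute value less than [1], i.e. [0]. Modulo each prime
the coefficients of equal points must then sum to [0], which is a trivial solution.

Decay: averaged over [Q], the exponential sum at frequency [eta] over the [p / q] is large
only for the primes [q] with a multiple near [eta], and boundedly many primes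
larger than [W] divide a given integer of size [W ^ O(1)]. This gives a
bound [W ^ (-1 + o(1))] up to frequency [Y ^ 4], i.e. [eta ^ (-1/4 + o(1))], and the
change of the Fourier transform at this stage is negligible for small frequencies.

Upper bound: the set is covered by the at most [Y] sets of points within
[Y ^ -4] of some [p / q], [q] fixed. Testing a measure with decay exponent
[beta / 2 > 1 / 4] against Fejer kernels of order [Y ^ 3] in [q * x] shows that
the total mass of these sets tends to [0]. *)

Set Implicit Arguments.
Unset Strict Implicit.
Unset Printing Implicit Defensive.
Import Order.TTheory GRing.Theory Num.Theory.
Import numFieldNormedType.Exports.

(** * Prime numbers in [(W, Y]] *)

(** By Legendre's formula the exponent is the sum over [k] of [2m %/ p^k - 2 (m %/ p^k)]. Each term
    is at most [1] and vanishes once [p^k > 2m]. *)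
Lemma logn_bin_central p m : prime p -> 0 < m -> p ^ logn p 'C(m.*2, m) <= m.*2.
Proof.
move=> pp mpos; have p1 := prime_gt1 pp.
have m0 : 0 < m.*2 by rewrite double_gt0.
suff le_log : logn p 'C(m.*2, m) <= trunc_log p m.*2.
  by apply: leq_trans (trunc_logP p1 m0); rewrite leq_exp2l.
have := @bin_fact m.*2 m; rewrite -addnn leq_addr addnK => /(_ isT) E.
have := congr1 (logn p) E; rewrite !lognM ?muln_gt0 ?fact_gt0 ?bin_gt0 ?leq_addr //.
rewrite addnn !logn_fact //.
have ext : \sum_(1 <= k < m.+1) m %/ p ^ k = \sum_(1 <= k < m.*2.+1) m %/ p ^ k.
  rewrite [RHS](big_cat_nat (n := m.+1)) //=; last by rewrite ltnS -addnn leq_addr.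
  rewrite [X in _ + X]big_nat_cond [X in _ + X]big1 ?addn0 // => k.
  rewrite andbT => /andP[mk _]; apply: divn_small.
  by apply: leq_trans (ltn_expl k p1); rewrite leqW.
move=> {}E. rewrite ext in E.
have le2 : \sum_(1 <= k < m.*2.+1) m.*2 %/ p ^ k <=
    \sum_(1 <= k < m.*2.+1) ((m %/ p ^ k).*2 + (p ^ k <= m.*2)).
  apply: leq_sum => k _; have pk : 0 < p ^ k by rewrite expn_gt0 prime_gt0.
  case: (leqP (p ^ k)) => h; last by rewrite divn_small.
  by rewrite addn1 -ltnS ltn_divLR //; have := divn_eq m (p ^ k); have := ltn_mod m (p ^ k); nia.
have cnt : \sum_(1 <= k < m.*2.+1) (p ^ k <= m.*2) <= trunc_log p m.*2.
  have := trunc_log_ltn m.*2 p1; set L := trunc_log _ _ => hL.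
  have LM : L <= m.*2.
    by apply: leq_trans (ltnW (ltn_expl _ p1)) (trunc_logP p1 m0).
  rewrite (big_cat_nat (n := L.+1)) //= [X in _ + X]big_nat_cond [X in _ + X]big1 ?addn0.
    apply: leq_trans (_ : \sum_(1 <= k < L.+1) 1 <= L); last by rewrite sum_nat_const_nat muln1 subn1.
    by apply: leq_sum => k _; exact: leq_b1.
  move=> k; rewrite andbT => /andP[Lk _]; apply/eqP; rewrite eqb0 -ltnNge.
  by apply: leq_trans hL _; rewrite leq_exp2l.
have dbl : \sum_(1 <= k < m.*2.+1) (m %/ p ^ k).*2 =
    (\sum_(1 <= k < m.*2.+1) m %/ p ^ k) + \sum_(1 <= k < m.*2.+1) m %/ p ^ k.
  by rewrite -big_split /=; apply: eq_bigr => k _; rewrite addnn.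
by rewrite big_split /= dbl in le2; lia.
Qed.

(** Pascal's rule and symmetry give [C(2n+2, n+1) = 2 C(2n+1, n+1) >= 2 C(2n, n)]. *)
Lemma expn2_le_bin_central n : 2 ^ n <= 'C(n.*2, n).
Proof.
elim: n => [|n IHn]; first by rewrite bin0.
rewrite doubleS binS.
have -> : 'C(n.*2.+1, n) = 'C(n.*2.+1, n.+1).
  by rewrite -bin_sub; [congr ('C(_, _)) |]; rewrite -addnn; lia.
by rewrite binS expnS; lia.
Qed.

Definition primes_upto n := [seq p <- index_iota 0 n.+1 | prime p].

(* Every prime power dividing 'C(2n, n) is at most 2n. *)
Lemma chebyshev_lower n : 2 ^ n <= n.*2 ^ size (primes_upto n.*2).
Proof.
case: n => [|n]; first by [].
set m := n.+1.
apply: leq_trans (expn2_le_bin_central m) _.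
have C0 : 0 < 'C(m.*2, m) by rewrite bin_gt0 -addnn leq_addr.
have -> : 'C(m.*2, m) = \prod_(p <- primes 'C(m.*2, m)) p ^ logn p 'C(m.*2, m).
  by rewrite [LHS](prod_prime_decomp C0) prime_decompE big_map.
apply: leq_trans (_ : \prod_(p <- primes 'C(m.*2, m)) m.*2 <= _).
  rewrite big_seq [X in _ <= X]big_seq; apply: leq_prod => p.
  by rewrite mem_primes => /andP[pp _]; exact: logn_bin_central.
rewrite big_const_seq count_predT iter_muln_1 leq_exp2l; last by rewrite -addnn /m; lia.
apply: uniq_leq_size (primes_uniq _) _ => p.
rewrite mem_primes => /and3P[pp _ pC]; rewrite mem_filter pp mem_index_iota ltnS /=.
have : 0 < logn p 'C(m.*2, m) by rewrite logn_gt0 mem_primes pp C0.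
move=> /(leq_pexp2l (prime_gt0 pp)); rewrite expn1 => /leq_trans; apply.
exact: logn_bin_central.
Qed.

(** With [Y = 2^(ts)] and [W = 2^(t(s-1))], Chebyshev's bound leaves at least [Y / (2ts)] primes up
    to [Y], and at most [W] of them are at most [W]. The ratio [Y / W = 2^t] eventually exceeds
    [2ts(N+1)]. Later [N] is the number of intervals, each of which receives [W] primes. *)
Lemma many_primes s N : 0 < s -> exists T, forall t, T <= t ->
  exists P : seq nat, [/\ uniq P,
    {in P, forall p, [&& prime p, 2 ^ (t * s.-1) < p & p <= 2 ^ (t * s)]} &
    N * 2 ^ (t * s.-1) <= size P].
Proof.
move=> s0; exists (2 * s * N.+1 + 4) => t tT.
set W := 2 ^ (t * s.-1); set Y := 2 ^ (t * s).
exists [seq p <- primes_upto Y | W < p]; split.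
- by rewrite !filter_uniq // iota_uniq.
- move=> p; rewrite !mem_filter mem_index_iota ltnS => /and3P[-> -> /andP[_ ->]].
  by [].
have ts0 : 0 < t * s by rewrite muln_gt0 s0; lia.
have YE : Y = (2 ^ (t * s).-1).*2 by rewrite -mul2n -expnS prednK.
(* Taking logarithms in base 2, the bound becomes [Y / 2 <= t * s * c]. *)
have := chebyshev_lower (2 ^ (t * s).-1); rewrite -YE {2}/Y -expnM leq_exp2l //.
set c := size (primes_upto Y) => hc.
have splt : c = size [seq p <- primes_upto Y | W < p] + size [seq p <- primes_upto Y | p <= W].
  rewrite /c -(count_predC (fun p => W < p) (primes_upto Y)) !size_filter.
  by congr (_ + _); apply: eq_count => p /=; rewrite -leqNgt.
have small : size [seq p <- primes_upto Y | p <= W] <= W.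
  rewrite -[X in _ <= X](size_iota 1); apply: uniq_leq_size.
    by rewrite !filter_uniq // iota_uniq.
  move=> p; rewrite !mem_filter mem_iota => /and3P[pW pp _].
  by rewrite add1n ltnS pW prime_gt0.
have tt : forall k, 4 <= k -> k * k <= 2 ^ k.
  elim=> // k IH; case: (ltnP k 4) => h4; first by move=> ?; have -> : k = 3 by lia.
  by move=> _; have := IH h4; rewrite expnS; nia.
have big : 2 * (t * s) * N.+1 <= 2 ^ t.
  by apply: leq_trans (tt t _); nia.
have : t * s * (N.+1 * W) <= t * s * c.
  apply: leq_trans hc; have : 2 * (t * s * (N.+1 * W)) <= 2 ^ t * W by nia.
  rewrite /W -expnD -mulnS prednK // -/Y YE; lia.
rewrite leq_pmul2l // splt; lia.
Qed.

(** The product of the distinct prime divisors divides [N] and is at least [W] to the power of their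
    number. *)
Lemma count_prime_divisors_lt (Q : seq nat) W k N : uniq Q ->
  {in Q, forall q, prime q && (W < q)} -> 0 < W -> 0 < N -> N < W ^ k ->
  count (fun q => q %| N) Q <= k.
Proof.
move=> uQ hQ W0 N0 Nk; rewrite -size_filter; set P := [seq q <- Q | q %| N].
have uP : uniq P by rewrite filter_uniq.
have hP : {in P, forall q, [&& prime q, W < q & q %| N]}.
  by move=> q; rewrite mem_filter => /andP[-> /hQ /andP[-> ->]].
rewrite leqNgt; apply/negP => kP.
have dv : \prod_(q <- P) q %| N.
  elim: P uP hP {kP} => [|q P IH] /=; first by rewrite big_nil.
  move=> /andP[qP uP] hP; have /and3P[pq _ qN] := hP q (mem_head _ _).
  rewrite big_cons Gauss_dvd ?qN /=; last first.
    rewrite prime_coprime // Euclid_dvd_prod // big_has; apply/hasPn => r rP.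
    have /and3P[pr _ _] : [&& prime r, W < r & r %| N] by apply: hP; rewrite inE rP orbT.
    by rewrite /= dvdn_prime2 //; apply: contraNneq qP => ->.
  by apply: IH => // r rP; apply: hP; rewrite inE rP orbT.
have := dvdn_leq N0 dv; apply/negP; rewrite -ltnNge.
apply: leq_trans Nk _; apply: leq_trans (_ : W ^ size P <= _).
  by rewrite leq_pexp2l // ltnW.
rewrite -iter_muln_1 -(count_predT P) -big_const_seq.
rewrite big_seq [X in _ <= X]big_seq; apply: leq_prod => q /hP /and3P[_ Wq _].
exact: ltnW.
Qed.

Local Open Scope classical_set_scope.
Local Open Scope ring_scope.

(** * Trigonometric sums over arithmetic progressions *)

Lemma le_of_eq (R : numDomainType) (x y : R) : x = y -> x <= y.
Proof. by move=> ->. Qed.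

Section trig.
Variable R : realType.
Implicit Types x y th eta u l : R.

Lemma sin_lip x y : `|sin x - sin y| <= `|x - y|.
Proof.
wlog xy : x y / y <= x.
  by move=> H; case/orP: (le_total x y) => ?; [rewrite distrC (distrC x)|]; exact: H.
move: xy; rewrite le_eqVlt => /predU1P[->|xy]; first by rewrite subrr normr0.
have [| c _ ->] := @MVT R sin cos y x xy (fun z _ => is_derive_sin z).
  by exact/continuous_subspaceT/continuous_sin.
by rewrite normrM ler_piMl // cos_max.
Qed.

Lemma cos_lip x y : `|cos x - cos y| <= `|x - y|.
Proof.
by rewrite -!sinDpihalf; apply: le_trans (sin_lip _ _) _; rewrite opprD addrACA subrr addr0.
Qed.

Lemma sin_le_norm x : `|sin x| <= `|x|.
Proof. by have := sin_lip x 0; rewrite sin0 !subr0. Qed.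

Lemma sin_sub_id x : 0 <= x -> `|sin x - x| <= x ^+ 2.
Proof.
rewrite le_eqVlt => /predU1P[<-|x0]; first by rewrite sin0 subr0 normr0 sqr_ge0.
have der z : z \in `]0, x[ -> is_derive z 1 (fun t => sin t - t) (cos z - 1).
  by move=> _; apply: is_deriveB.
have [| c ] := @MVT R _ _ 0 x x0 der.
  apply/continuous_subspaceT => z; apply: cvgB; first exact: continuous_sin.
  exact: cvg_id.
rewrite in_itv /= sin0 !subr0 => /andP[c0 cx] ->.
rewrite normrM (gtr0_norm x0) expr2 ler_pM2r //.
by have := cos_lip c 0; rewrite cos0 subr0 (gtr0_norm c0) => /le_trans; apply; exact: ltW.
Qed.

(* [sin x = 2 sin (x/2) cos (x/2) >= x cos (x/2) ^ 2 >= x / 2] *)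
Lemma half_le_sin x : 0 <= x <= pi / 2 -> x / 2 <= sin x.
Proof.
move=> /andP[]; rewrite le_eqVlt => /predU1P[<- _|x0 x1]; first by rewrite sin0 mul0r.
set y := x / 2; have y0 : 0 < y by rewrite divr_gt0.
have yx : y * 2 = x by rewrite /y divfK.
have [| c ] := @MVT R sin cos 0 y y0 (fun z _ => is_derive_sin z).
  by exact/continuous_subspaceT/continuous_sin.
rewrite in_itv /= sin0 !subr0 => /andP[c0 cy] E.
have p2 := pi_gt0 R.
have cc : cos y <= cos c.
  by rewrite ltW // ltr_cos // in_itv /=; lra.
have cy0 : 0 <= cos y by apply: cos_ge0_pihalf; lra.
have cx0 : 0 <= cos x by apply: cos_ge0_pihalf; lra.
have xe : x = y *+ 2 by rewrite mulr2n; lra.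
clearbody y; rewrite xe cos_mulr2n in cx0; rewrite xe sin_mulr2n E.
have h1 : 1 <= cos y ^+ 2 *+ 2 by lra.
rewrite expr2 in h1.
have h2 : cos y * cos y <= cos y * cos c by rewrite ler_wpM2l.
have h3 : y * 1 <= y * (cos y * cos c *+ 2).
  by apply: ler_wpM2l; [exact: ltW | rewrite mulr2n in h1 *; lra].
by rewrite mulr1 in h3; apply: le_trans h3 _; apply: le_of_eq; rewrite !mulr2n; ring.
Qed.

(** Up to sign [sin (pi * y)] depends only on the distance [z] from [y] to [k], and [half_le_sin]
    gives at least [pi * z / 2 >= z]. *)
Lemma dist_le_sin_pi y (k : nat) : `|y - k%:R| <= 1 / 2 ->
  `|y - k%:R| <= `|sin (pi * y)|.
Proof.
have -> : `|sin (pi * y)| = `|sin (pi * `|y - k%:R|)|.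
  have -> : pi * y = pi * (y - k%:R) + pi *+ k by rewrite -mulr_natr; ring.
  rewrite (alternatingn (@sinDpi R)) normrM normrX normrN1 expr1n mul1r.
  by case: (ger0P (y - k%:R)) => // _; rewrite mulrN sinN normrN.
move: (`|y - k%:R|) (normr_ge0 (y - k%:R)) => z z0 z1.
have p2 := pi_ge2 R.
have := @half_le_sin (pi * z); rewrite mulr_ge0 ?pi_ge0 //= => H.
apply: le_trans (ler_norm _); apply: le_trans (H _); last by nra.
by nra.
Qed.

(** Telescoping: [2 sin (h/2) cos v = sin (v + h/2) - sin (v - h/2)]. *)
Lemma geom_cos (m : nat) (a h : R) :
  2 * sin (h / 2) * \sum_(r < m) cos (h * r%:R + a) =
  sin (h * (m%:R - 1 / 2) + a) - sin (- (h / 2) + a).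
Proof.
elim: m => [|m IH].
  by rewrite big_ord0 mulr0 sub0r mulrN mulrA mulr1 subrr.
rewrite big_ord_recr /= mulrDr IH.
have -> : h * (m.+1%:R - 1 / 2) + a = (h * m%:R + a) + h / 2.
  by rewrite -addn1 natrD; field.
have -> : h * (m%:R - 1 / 2) + a = (h * m%:R + a) - h / 2 by field.
by rewrite [sin (_ + _ + h / 2)]sinD [sin (_ - h / 2)]sinB; ring.
Qed.

(* Takes the junk value 0 at 0. *)
Definition sinc x := sin x / x.

Lemma sinc_le1 x : `|sinc x| <= 1.
Proof.
have [->|x0] := eqVneq x 0; first by rewrite /sinc invr0 mulr0 normr0.
by rewrite normf_div ler_pdivrMr ?normr_gt0 // mul1r sin_le_norm.
Qed.

Lemma sinc_le_inv x : 0 < x -> `|sinc x| <= x^-1.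
Proof.
by move=> x0; rewrite normrM (@gtr0_norm _ x^-1) ?invr_gt0 // ler_piMl ?sin_max // invr_ge0 ltW.
Qed.

Lemma sinc_sub1 x : 0 < x -> `|sinc x - 1| <= x.
Proof.
move=> x0; have -> : sinc x - 1 = (sin x - x) / x by rewrite /sinc; field; rewrite gt_eqF.
rewrite normf_div (gtr0_norm x0) ler_pdivrMr // -expr2; exact/sin_sub_id/ltW.
Qed.

(** The phase [th] makes every estimate cover cosines and sines at once. *)
Definition run (p0 m q : nat) eta th :=
  m%:R^-1 * \sum_(r < m) cos (2 * pi * eta * ((p0 + r)%:R / q%:R) + th).

Lemma run_le1 p0 m q eta th : `|run p0 m q eta th| <= 1.
Proof.
case: m => [|m]; first by rewrite /run big_ord0 mulr0 normr0.
rewrite normrM ger0_norm ?invr_ge0 // mulrC ler_pdivrMr ?ltr0n // mul1r.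
apply: le_trans (ler_norm_sum _ _ _) _.
apply: le_trans (ler_sum _ (fun i _ => cos_max _)) _.
by rewrite sumr_const card_ord.
Qed.

(** Stated without division, so that it also holds where [sin (h/2)] vanishes. *)
Lemma run_closed p0 m q eta th : (0 < m)%N -> (0 < q)%N ->
  let h := 2 * pi * eta / q%:R in
  2 * sin (h / 2) * m%:R * run p0 m q eta th =
  sin (h * (p0%:R + m%:R - 1 / 2) + th) - sin (h * (p0%:R - 1 / 2) + th).
Proof.
move=> m0 q0 h; rewrite /run mulrA mulfK; last by rewrite pnatr_eq0 -lt0n.
have -> : \sum_(r < m) cos (2 * pi * eta * ((p0 + r)%:R / q%:R) + th) =
   \sum_(r < m) cos (h * r%:R + (h * p0%:R + th)).
  by apply: eq_bigr => r _; congr cos; rewrite /h natrD; ring.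
by rewrite geom_cos; congr (sin _ - sin _); ring.
Qed.

(** In the closed form the right side is at most [2], while [|sin (h/2)|] is at least the distance
    from [eta / q] to the nearest integer. The run is thus small unless [eta] is close to a multiple
    of [q]. *)
Lemma run_high p0 m q eta th (k : nat) : (0 < m)%N -> (0 < q)%N ->
  `|eta / q%:R - k%:R| <= 1 / 2 -> eta != (k * q)%:R ->
  `|run p0 m q eta th| <= q%:R / (m%:R * `|eta - (k * q)%:R|).
Proof.
move=> m0 q0 hk ne.
have d0 : 0 < `|eta - (k * q)%:R| by rewrite normr_gt0 subr_eq0.
have m0R : 0 < m%:R :> R by rewrite ltr0n.
have q0R : 0 < q%:R :> R by rewrite ltr0n.
rewrite ler_pdivlMr ?mulr_gt0 //.
have := run_closed p0 eta th m0 q0; set h := _ / q%:R => /= E.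
have hs : `|eta - (k * q)%:R| <= q%:R * `|sin (h / 2)|.
  have := dist_le_sin_pi hk.
  have -> : pi * (eta / q%:R) = h / 2 by rewrite /h; field; rewrite gt_eqF.
  move=> H; rewrite mulrC -ler_pdivrMr //; apply: le_trans H.
  rewrite -[X in _ / X](@gtr0_norm _ q%:R) // -normf_div natrM; apply: le_of_eq.
  by congr `|_|; field; rewrite gt_eqF.
move: (run p0 m q eta th) E => rn E.
have b2 : `|2 * sin (h / 2) * m%:R * rn| <= 2.
  rewrite E; apply: le_trans (ler_normB _ _) _.
  have := sin_max (h * (p0%:R + m%:R - 1 / 2) + th).
  have := sin_max (h * (p0%:R - 1 / 2) + th); lra.
rewrite !normrM (@gtr0_norm _ m%:R) // (@gtr0_norm _ 2) // in b2.
apply: le_trans (_ : `|rn| * (m%:R * (q%:R * `|sin (h / 2)|)) <= _).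
  by rewrite ler_wpM2l // ler_pM2l.
have {}b2 : `|sin (h / 2)| * m%:R * `|rn| <= 1.
  by rewrite -(@ler_pM2l _ 2) ?ltr0n // mulr1 !mulrA.
by have := ler_wpM2r (ltW q0R) b2; rewrite mul1r; apply: le_trans; apply: le_of_eq; ring.
Qed.

(** The sinc term is the average of the cosine over the interval of length [l] around [u]. Both
    averages are a difference of sines at the two ends over a normalisation. The two hypotheses say
    that the ends, scaled by [q], differ by at most [4]; the shift [1/2] comes from [geom_cos]. *)
Lemma run_low p0 m q eta th u l :
  (0 < m)%N -> (0 < q)%N -> (m <= q)%N -> 0 < eta -> 0 < l ->
  `|p0%:R - 1 / 2 - q%:R * (u - l / 2)| <= 4 ->
  `|p0%:R + m%:R - 1 / 2 - q%:R * (u + l / 2)| <= 4 ->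
  `|run p0 m q eta th - sinc (pi * eta * l) * cos (2 * pi * eta * u + th)|
     <= 16 * (1 + eta) / (q%:R * l).
Proof.
move=> m0 q0 mq e0 l0 hlo hhi.
have m0R : 0 < m%:R :> R by rewrite ltr0n.
have q0R : 0 < q%:R :> R by rewrite ltr0n.
have p0' := pi_gt0 R.
have := run_closed p0 eta th m0 q0; set h := _ / q%:R => /= E.
have h0 : 0 < h by rewrite divr_gt0 // !mulr_gt0.
set rn := run _ _ _ _ _ in E *; set J := sinc _ * _.
(* [D] is [2 * pi * eta * l], the normalisation of [J]. Below, [bN] compares the numerators and [bD]
   the normalisations. *)
set D := h * (q%:R * l).
have D0 : 0 < D by do 2?apply: mulr_gt0 => //.
have hq : h * q%:R = 2 * pi * eta by rewrite /h divfK // gt_eqF.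
have EJ : D * J = sin (h * (q%:R * (u + l / 2)) + th) - sin (h * (q%:R * (u - l / 2)) + th).
  have -> : h * (q%:R * (u + l / 2)) + th = (2 * pi * eta * u + th) + pi * eta * l.
    by rewrite [h * _]mulrA hq; field.
  have -> : h * (q%:R * (u - l / 2)) + th = (2 * pi * eta * u + th) - pi * eta * l.
    by rewrite [h * _]mulrA hq; field.
  rewrite sinD sinB /J /D [h * _]mulrA hq /sinc; move: (pi : R) p0' => P P0; field.
  by rewrite !gt_eqF.
have bN : `|2 * sin (h / 2) * m%:R * rn - D * J| <= 8 * h.
  rewrite E EJ.
  have -> : forall a b c d : R, a - b - (c - d) = (a - c) - (b - d) by move=> *; ring.
  apply: le_trans (ler_normB _ _) _.
  have -> : 8 * h = h * 4 + h * 4 by ring.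
  apply: lerD; apply: le_trans (sin_lip _ _) _.
    have -> : forall a b : R, h * a + th - (h * b + th) = h * (a - b) by move=> *; ring.
    by rewrite normrM gtr0_norm // ler_pM2l.
  have -> : forall a b : R, h * a + th - (h * b + th) = h * (a - b) by move=> *; ring.
  by rewrite normrM gtr0_norm // ler_pM2l.
have bD : `|D - 2 * sin (h / 2) * m%:R| <= 8 * h + m%:R * h * h / 2.
  have -> : D - 2 * sin (h / 2) * m%:R =
     h * (q%:R * l - m%:R) - 2 * m%:R * (sin (h / 2) - h / 2) by rewrite /D; field.
  apply: le_trans (ler_normB _ _) _; apply: lerD.
    rewrite normrM gtr0_norm // (mulrC h) ler_pM2r //.
    have -> : q%:R * l - m%:R = (p0%:R - 1 / 2 - q%:R * (u - l / 2)) -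
         (p0%:R + m%:R - 1 / 2 - q%:R * (u + l / 2)) by field.
    apply: le_trans (ler_normB _ _) _. lra.
  have H2 : 0 <= 2 * m%:R :> R by rewrite mulr_ge0 ?ler0n.
  rewrite normrM (ger0_norm H2).
  have := @sin_sub_id (h / 2); rewrite divr_ge0 ?(ltW h0) // => /(_ isT) H.
  apply: le_trans (ler_wpM2l H2 H) _.
  by apply: le_of_eq; field.
have r1 : `|rn| <= 1 by exact: run_le1.
have bT : `|D * (rn - J)| <= 16 * h + m%:R * h * h / 2.
  have -> : D * (rn - J) = (D - 2 * sin (h / 2) * m%:R) * rn +
     (2 * sin (h / 2) * m%:R * rn - D * J) by ring.
  apply: le_trans (ler_normD _ _) _; rewrite normrM.
  have : `|D - 2 * sin (h / 2) * m%:R| * `|rn| <= `|D - 2 * sin (h / 2) * m%:R| * 1.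
    by rewrite ler_wpM2l.
  lra.
rewrite normrM gtr0_norm // in bT.
rewrite ler_pdivlMr; last by apply: mulr_gt0.
rewrite -(ler_pM2l h0).
apply: le_trans (_ : 16 * h + m%:R * h * h / 2 <= _).
  by apply: le_trans bT; apply: le_of_eq; rewrite /D; ring.
have mh : m%:R * h <= 2 * pi * eta by rewrite -hq mulrC ler_pM2l // ler_nat.
have p4 : pi < 4 :> R by have := pihalf_lt2 R; lra.
have pe : pi * eta <= 4 * eta by rewrite ler_pM2r // ltW.
nra.
Qed.

End trig.

(** * Averaging the exponential sums over a set of primes *)

Section node.
Variable R : realType.
Implicit Types x y th eta u l : R.

Lemma harmonic_pow2_le a : \sum_(d < 2 ^ a) (d.+1%:R : R)^-1 <= a.+1%:R.
Proof.
elim: a => [|a IH]; first by rewrite expn0 big_ord1 invr1.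
rewrite expnS mul2n -addnn big_split_ord /= -[a.+2]addn1 natrD.
apply: lerD => //.
apply: le_trans (_ : \sum_(i < 2 ^ a) (2 ^ a)%:R^-1 <= _).
  apply: ler_sum => i _; rewrite lef_pV2 ?posrE ?ltr0n ?expn_gt0 // ler_nat.
  by rewrite leqW // leq_addr.
rewrite sumr_const card_ord -[_ *+ _]mulr_natr mulVf // pnatr_eq0 expn_eq0.
Qed.

Definition nearest q eta := Num.truncn (eta / q%:R + 1 / 2).

Lemma nearestP q eta : 0 <= eta -> `|eta / q%:R - (nearest q eta)%:R| <= 1 / 2.
Proof.
move=> e0; have := @truncn_itv R (eta / q%:R + 1 / 2).
rewrite addr_ge0 ?divr_ge0 // => /(_ isT); rewrite -/(nearest q eta) -[(nearest q eta).+1%:R]natr1.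
by rewrite ler_norml; lra.
Qed.

Definition gap (a b : nat) := ((a - b) + (b - a))%N.

(** A form of [run_high] in terms of integers only. For a gap [d <= 1] the trivial bound suffices;
    for [d >= 2] the true distance is at least [d - 1 >= (d + 1) / 3], whence [6 = 2 * 3]. *)
Lemma run_gap p0 m q eta th l : 0 < l <= 1 -> q%:R * l / 2 <= m%:R -> (0 < q)%N ->
  0 <= eta ->
  `|run p0 m q eta th| <= 6 / l / (gap (nearest q eta * q) (Num.truncn eta)).+1%:R.
Proof.
move=> /andP[l0 l1] mq q0 e0; set k := nearest q eta.
set d := gap (k * q) _.
have il : 1 <= l^-1 by rewrite invf_ge1 ?l0.
have q0R : 0 < q%:R :> R by rewrite ltr0n.
have m0R : 0 < m%:R :> R by apply: lt_le_trans mq; rewrite divr_gt0 ?mulr_gt0.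
have m0 : (0 < m)%N by rewrite -(ltr0n R).
rewrite ler_pdivlMr ?ltr0n //.
have r1 := run_le1 p0 m q eta th.
have [d2|d2] := ltnP d 2.
  apply: le_trans (_ : 1 * d.+1%:R <= _); first by rewrite ler_pM2r ?ltr0n.
  have : d.+1%:R <= 2 :> R by rewrite ler_nat.
  lra.
have f1 := @truncn_itv R eta e0; rewrite -addn1 natrD in f1.
have dE : d%:R <= `|(k * q)%:R - (Num.truncn eta)%:R| :> R.
  rewrite /d /gap; case: (leqP (k * q) (Num.truncn eta)) => h.
    by rewrite (eqP h) add0n natrB // distrC ler_norm.
  by rewrite (eqP (ltnW h)) addn0 natrB ?(ltnW h) // ler_norm.
have d1 : d%:R - 1 <= `|eta - (k * q)%:R|.
  rewrite distrC; have := ler_distD eta (k * q)%:R (Num.truncn eta)%:R.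
  have : `|eta - (Num.truncn eta)%:R| <= 1 by rewrite ger0_norm; lra.
  lra.
have d2R : 2 <= d%:R :> R by rewrite ler_nat.
have ne : eta != (k * q)%:R.
  by rewrite -subr_eq0 -normr_gt0; lra.
have := run_high p0 th m0 q0 (nearestP q e0) ne; rewrite -/k.
set X := `|eta - _| in d1 *; move=> H.
have X0 : 0 < X by lra.
have H1 : q%:R / (m%:R * X) <= 2 / (l * X).
  rewrite ler_pdivrMr ?mulr_gt0 // mulrAC ler_pdivlMr ?mulr_gt0 //; nra.
apply: le_trans (_ : 2 / (l * X) * d.+1%:R <= _).
  by rewrite ler_pM2r ?ltr0n //; apply: le_trans H H1.
rewrite mulrAC ler_pdivrMr ?mulr_gt0 //.
rewrite -[d.+1%:R]natr1.
have -> : 6 / l * (l * X) = 6 * X by field; rewrite gt_eqF.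
lra.
Qed.

Lemma run_far p0 m q eta th l : 0 < l -> q%:R * l / 2 <= m%:R -> (0 < q)%N ->
  0 < eta -> nearest q eta = 0%N -> `|run p0 m q eta th| <= 2 / (l * eta).
Proof.
move=> l0 mq q0 e0 k0.
have q0R : 0 < q%:R :> R by rewrite ltr0n.
have m0R : 0 < m%:R :> R by apply: lt_le_trans mq; rewrite divr_gt0 ?mulr_gt0.
have m0 : (0 < m)%N by rewrite -(ltr0n R).
have := run_high p0 th m0 q0 (nearestP q (ltW e0)); rewrite k0 mul0n subr0 (gt_eqF e0).
move=> /(_ isT); rewrite (gtr0_norm e0) => /le_trans; apply.
rewrite ler_pdivrMr ?mulr_gt0 // mulrAC ler_pdivlMr ?mulr_gt0 //; nra.
Qed.

Section sum_over_primes.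
Variables (Q : seq nat) (W Y A : nat) (P m : nat -> nat).
Variables (eta th l : R).
Hypothesis uQ : uniq Q.
Hypothesis hQ : {in Q, forall q, [&& prime q, (W < q)%N & (q <= Y)%N]}.
Hypothesis W0 : (0 < W)%N.
Hypothesis YA : (Y <= 2 ^ A)%N.
Hypothesis l01 : 0 < l <= 1.
Hypothesis hm : {in Q, forall q, q%:R * l / 2 <= (m q)%:R}.
Hypothesis e0 : 0 < eta.
Variable K : nat.
Hypothesis hK : (Num.truncn eta + 2 ^ A.+1 < W ^ K)%N.

Let f := Num.truncn eta.
Let k q := nearest q eta.
Let d q := gap (k q * q) f.

Lemma gap_lt q : q \in Q -> (d q < 2 ^ A.+1)%N.
Proof.
move=> qQ; have /and3P[pq _ qY] := hQ qQ; have q0 := prime_gt0 pq.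
have q0R : 0 < q%:R :> R by rewrite ltr0n.
have h1 := nearestP q (ltW e0); rewrite -/(k q) in h1.
have h2 : `|eta - (k q * q)%:R| <= q%:R / 2.
  have -> : eta - (k q * q)%:R = (eta / q%:R - (k q)%:R) * q%:R.
    by rewrite natrM; field; rewrite gt_eqF.
  by rewrite normrM (gtr0_norm q0R); have := ler_wpM2r (ltW q0R) h1; lra.
have f1 := @truncn_itv R eta (ltW e0); rewrite -addn1 natrD -/f in f1.
have qY' : q%:R <= (2 ^ A)%:R :> R by rewrite ler_nat; exact: leq_trans YA.
have A1 : 1 <= (2 ^ A)%:R :> R by rewrite ler1n expn_gt0.
rewrite -(ltr_nat R) expnS natrM.
rewrite ler_norml in h2.
rewrite /d /gap; case: (leqP (k q * q) f) => h.
  by rewrite (eqP h) add0n natrB //; lra.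
by rewrite (eqP (ltnW h)) addn0 natrB ?(ltnW h) //; lra.
Qed.

(** If the nearest multiple of [q] is nonzero and at gap [j] from [f], then [q] divides the nonzero
    number [f + j] or [f - j]. Each of these is below [W ^ K], so it has at most [K] prime divisors
    above [W]. *)
Lemma count_gap (j : nat) : (j < 2 ^ A.+1)%N ->
  (count (fun q => (0 < k q) && (d q == j))%N Q <= 2 * K)%N.
Proof.
move=> jA.
have cnt (N : nat) : (N < W ^ K)%N -> (count (fun q => (0 < N) && (q %| N))%N Q <= K)%N.
  case: N => [|N] NK; first by rewrite (@eq_count _ _ pred0) ?count_pred0.
  apply: leq_trans (@count_prime_divisors_lt Q W K N.+1 uQ _ W0 isT NK) => //.
  by move=> q /hQ /and3P[-> ->].
apply: leq_trans (_ : (count (fun q => (0 < f + j) && (q %| f + j)) Q +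
   count (fun q => (0 < f - j) && (q %| f - j)) Q <= _)%N); last first.
  rewrite mul2n -addnn; apply: leq_add; apply: cnt; rewrite /f; lia.
rewrite -count_predUI; apply: leq_trans (leq_addr _ _).
elim: Q hQ => //= q Q' IH hQ'.
apply: leq_add; last by apply: IH => r rQ; apply: hQ'; rewrite inE rQ orbT.
have /and3P[pq _ _] := hQ' q (mem_head _ _); have q0 := prime_gt0 pq.
case: (ltnP 0 (k q)) => //= k0; case: eqP => //= dj.
have kq0 : (0 < k q * q)%N by rewrite muln_gt0 k0.
have [E|E] : (k q * q = f + j)%N \/ (k q * q = f - j)%N by rewrite -dj /d /gap; lia.
  by rewrite -E kq0 dvdn_mull.
by rewrite -E kq0 dvdn_mull ?orbT.
Qed.

(** Primes whose nearest multiple is [0] contribute at most [2 / (l * eta)] each. The others are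
    sorted by their gap [j], with at most [2 * K] primes for each [j], and the weights [1 / (j + 1)]
    sum to a logarithm. *)
Lemma sum_run_le :
  `|\sum_(q <- Q) run (P q) (m q) q eta th| <=
    (size Q)%:R * (2 / (l * eta)) + 6 / l * (2 * K)%:R * A.+2%:R.
Proof.
have /andP[l0 _] := l01.
apply: le_trans (ler_norm_sum _ _ _) _.
apply: le_trans (_ : \sum_(q <- Q) (2 / (l * eta) +
    \sum_(j < 2 ^ A.+1) ((0 < k q)%N && (d q == j :> nat))%:R * (6 / l / j.+1%:R)) <= _).
  rewrite big_seq [X in _ <= X]big_seq; apply: ler_sum => q qQ.
  have /and3P[pq _ _] := hQ qQ; have q0 := prime_gt0 pq.
  have nn : 0 <= 2 / (l * eta) by rewrite divr_ge0 // mulr_ge0 // ltW.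
  case: (posnP (k q)) => k0.
    rewrite big1 ?addr0; last by move=> j _; rewrite mul0r.
    exact: run_far (hm qQ) q0 e0 k0.
  rewrite (bigD1 (Ordinal (gap_lt qQ))) //= eqxx mul1r big1 ?addr0.
    apply: le_trans (run_gap _ _ l01 (hm qQ) q0 (ltW e0)) _.
    by rewrite lerDr.
  by move=> j; rewrite -val_eqE /= eq_sym => /negbTE ->; rewrite mul0r.
rewrite big_split /= big_const_seq count_predT iter_addr_0; apply: lerD; first by rewrite -[_ *+ size Q]mulr_natl.
rewrite exchange_big /=.
apply: le_trans (_ : \sum_(j < 2 ^ A.+1) (6 / l * (2 * K)%:R) * j.+1%:R^-1 <= _).
  apply: ler_sum => j _; rewrite -mulr_suml -natr_sum.
  have -> : (\sum_(q <- Q) ((0 < k q)%N && (d q == j :> nat)) =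
     count (fun q => (0 < k q) && (d q == j))%N Q)%N by rewrite -sum1_count [RHS]big_mkcond; apply: eq_bigr => q _; case: (_ && _).
  rewrite mulrC.
  have -> : 6 / l * (2 * K)%:R / j.+1%:R = 6 / l / j.+1%:R * (2 * K)%:R by ring.
  apply: ler_wpM2l; first by rewrite !divr_ge0 // ltW.
  by rewrite ler_nat count_gap.
rewrite -mulr_sumr; apply: ler_wpM2l; last exact: harmonic_pow2_le.
by rewrite mulr_ge0 // divr_ge0 // ltW.
Qed.

End sum_over_primes.
End node.

(** * Comparison of an interval with its children *)

Section node.
Variable R : realType.
Implicit Types x y th eta u l : R.

(** The offsets [2] here and [3] in [p_count] keep all chosen fractions at distance at least [1 / q]
    from the ends of the interval, which leaves room for the child intervals. *)
Definition p_start q u l := (Num.truncn (q%:R * (u - l / 2)) + 2)%N.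
Definition p_count q l := (Num.truncn (q%:R * l) - 3)%N.

Lemma p_countP q l : 8 <= q%:R * l ->
  [/\ q%:R * l - 4 <= (p_count q l)%:R, (p_count q l)%:R <= q%:R * l - 3,
     (0 < p_count q l)%N & q%:R * l / 2 <= (p_count q l)%:R].
Proof.
move=> h; have := @truncn_itv R (q%:R * l); rewrite (le_trans _ h) // => /(_ isT).
rewrite -natr1 => f.
have c8 : (8 <= Num.truncn (q%:R * l))%N by rewrite truncn_ge_nat // (le_trans _ h).
have E : (p_count q l)%:R = (Num.truncn (q%:R * l))%:R - 3 :> R.
  by rewrite /p_count natrB //; apply: leq_trans c8.
by rewrite E; split; try lra; rewrite /p_count; lia.
Qed.

Lemma p_startP q u l : 0 <= q%:R * (u - l / 2) ->
  q%:R * (u - l / 2) + 1 <= (p_start q u l)%:R <= q%:R * (u - l / 2) + 2.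
Proof.
move=> h; have := @truncn_itv R (q%:R * (u - l / 2)) h.
by rewrite /p_start -natr1 natrD; lra.
Qed.

Definition node_sum (Q : seq nat) u l eta th :=
  (size Q)%:R^-1 * \sum_(q <- Q) run (p_start q u l) (p_count q l) q eta th.

Lemma node_sum_le1 Q u l eta th : `|node_sum Q u l eta th| <= 1.
Proof.
have [E|Q0] := eqVneq (size Q) 0%N; first by rewrite /node_sum E invr0 mul0r normr0.
rewrite normrM ger0_norm ?invr_ge0 // mulrC ler_pdivrMr ?ltr0n ?lt0n // mul1r.
apply: le_trans (ler_norm_sum _ _ _) _.
apply: le_trans (ler_sum _ (fun q _ => run_le1 _ _ q eta th)) _.
by rewrite big_const_seq count_predT iter_addr_0.
Qed.

Lemma node_low Q u l eta th (W : R) : (0 < size Q)%N -> 0 < l <= 1 -> l / 2 <= u ->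
  0 < eta -> 0 < W -> {in Q, forall q, (0 < q)%N && (W <= q%:R) && (8 <= q%:R * l)} ->
  `|node_sum Q u l eta th - sinc (pi * eta * l) * cos (2 * pi * eta * u + th)|
     <= 16 * (1 + eta) / (W * l).
Proof.
move=> Q0 /andP[l0 l1] lu e0 W0 hQ.
set J := _ * cos _; set B := _ / _.
have -> : node_sum Q u l eta th - J =
   (size Q)%:R^-1 * \sum_(q <- Q) (run (p_start q u l) (p_count q l) q eta th - J).
  rewrite sumrB big_const_seq count_predT iter_addr_0 mulrBr -[J *+ _]mulr_natl mulKf //.
  by rewrite pnatr_eq0 -lt0n.
rewrite normrM ger0_norm ?invr_ge0 // mulrC ler_pdivrMr ?ltr0n //.
apply: le_trans (ler_norm_sum _ _ _) _.
rewrite mulr_natr -iter_addr_0 -(count_predT Q) -big_const_seq big_seq [X in _ <= X]big_seq.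
apply: ler_sum => q /hQ /andP[/andP[q0 Wq] q8].
have q0R : 0 < q%:R :> R by rewrite ltr0n.
have lo : 0 <= q%:R * (u - l / 2) by rewrite mulr_ge0 ?subr_ge0 // ltW.
have := p_startP lo; have [c1 c2 c0 c3] := p_countP q8.
set p := (p_start q u l)%:R => pb.
apply: le_trans (_ : 16 * (1 + eta) / (q%:R * l) <= _); last first.
  rewrite ler_wpM2l ?mulr_ge0 // ?addr_ge0 // ?(ltW e0) //.
  by rewrite lef_pV2 ?posrE ?mulr_gt0 // ler_pM2r.
apply: run_low => //.
- rewrite -(ler_nat R); apply: le_trans c2 _; nra.
- by rewrite ler_norml -/p; lra.
- by rewrite ler_norml -/p; nra.
Qed.

Lemma norm_le_powR x a (c : R) : `|x| <= 1 -> 0 < c -> `|x| <= c -> 0 <= a <= 1 ->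
  `|x| <= c `^ a.
Proof.
move=> x1 c0 xc /andP[a0 a1]; have [c1|c1] := lerP 1 c.
  apply: le_trans x1 _; rewrite -[X in X <= _](powRr0 c).
  by rewrite ler_powR.
by apply: le_trans xc _; rewrite ger1_powR // c0 ltW.
Qed.

(** Tends to [-1/4], the decay corresponding to dimension [1/2]. At frequency [Y^4 = Z^(4s)] it
    allows [Z^(4-s)], which exceeds [1 / W = Z^(1-s)] by a factor [Z^3] that pays for the logarithm
    and the constants. *)
Definition rate (s : nat) : R := - (1 / 4) + s%:R^-1.

Lemma rate_ge_inv s x : 1 <= x -> x^-1 <= x `^ rate s.
Proof.
move=> x1; rewrite -powR_inv1 ?(le_trans _ x1) // ler_powR //.
by rewrite /rate; have : 0 <= s%:R^-1 :> R by []; lra.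
Qed.

Lemma rate_ge_sqrt s x : 1 <= x -> (Num.sqrt x)^-1 <= x `^ rate s.
Proof.
move=> x1; rewrite -powR12_sqrt ?(le_trans _ x1) // -powRN ler_powR //.
by rewrite /rate; have : 0 <= s%:R^-1 :> R by []; lra.
Qed.

(* The exponent [1/4 - 1/s] turns the scale [Y ^ 4 = Z ^ (4 s)] into [Z ^ (s - 4)]. *)
Lemma powR_scale s x (Z M : R) : (5 <= s)%N -> 1 <= x -> 1 <= Z -> 1 <= M ->
  (M * (Z ^+ s) ^+ 4 / x) `^ (- rate s) <= M * Z ^+ (s - 4) * x `^ rate s.
Proof.
move=> s5 x1 Z1 M1.
have x0 : 0 <= x by exact: le_trans x1.
have Z0 : 0 <= Z by exact: le_trans Z1.
have M0 : 0 <= M by exact: le_trans M1.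
have s0 : s%:R != 0 :> R by rewrite pnatr_eq0; lia.
have sp : 0 < s%:R :> R by rewrite ltr0n; lia.
rewrite powRM ?mulr_ge0 ?exprn_ge0 ?invr_ge0 // powRM ?exprn_ge0 //.
have -> : (x^-1) `^ (- rate s) = x `^ rate s.
  by rewrite -powR_inv1 // -powRrM mulN1r opprK.
have -> : ((Z ^+ s) ^+ 4) `^ (- rate s) = Z ^+ (s - 4).
  rewrite -exprM -powR_mulrn // -powRrM -[RHS]powR_mulrn //; congr (_ `^ _).
  rewrite natrM natrB; last by apply: leq_trans s5.
  by rewrite /rate; field.
apply: ler_wpM2r; first exact: powR_ge0.
apply: ler_wpM2r; first exact: exprn_ge0.
apply: ler1_powR => //; rewrite /rate.
have : 0 <= s%:R^-1 :> R by []; lra.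
Qed.

End node.

(** * One interval against its children, in all frequency ranges *)

Section node.
Variable R : realType.
Implicit Types x y th eta u l : R.

Section scale.
Variables (s t W Y : nat) (Z l M e : R).
Hypothesis WE : W%:R = Z ^+ s.-1.
Hypothesis YE : Y%:R = Z ^+ s.
Hypothesis Y2 : Y = (2 ^ (t * s))%N.
Hypothesis tZ : t%:R <= Z.
Hypothesis s5 : (5 <= s)%N.
Let s_arith : [/\ 1 <= s.-1, (s * 4 * 2).+1 <= s.-1 * 12, s.+1 <= s.-1 * 12, 0 < s
  & s.-1 = s - 4 + 3]%N.
Proof. by split; lia. Qed.
Hypotheses (l01 : 0 < l <= 1) (M1 : 1 <= M) (e0 : 0 < e).
(** [K1] to [K6] are the lower bounds on [Z = 2^t] used in the various frequency ranges;
    [node_estimate] secures all of them by taking [t] large. *)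
Hypothesis K1 : 20 ^+ 2 / (e * l) ^+ 2 <= Z.
Hypothesis K2 : ((12 / (l * e)) ^+ 2) ^+ 4 <= Z.
Hypothesis K3 : 16 <= Z.
Hypothesis K4 : (3 * M / e) ^+ 2 <= Z.
Hypothesis K5 : 468 * (s + 2)%:R * M / (e * l) <= Z.
Hypothesis K6 : 8 / l <= Z.
Variables (u : R) (Q : seq nat).
Hypothesis lu : l / 2 <= u.
Hypothesis uQ : uniq Q.
Hypothesis hQ : {in Q, forall q, [&& prime q, (W < q)%N & (q <= Y)%N]}.
Hypothesis szQ : size Q = W.
Variables (eta th : R).
Hypothesis eta0 : 0 < eta.
Let x := 1 + eta.
Let delta := (M * (Y%:R) ^+ 4)^-1.

Let Z1 : 1 <= Z. Proof. by move: K3; lra. Qed.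
Let Z0 : 0 < Z. Proof. exact: lt_le_trans Z1. Qed.
Let l0 : 0 < l. Proof. by case/andP: l01. Qed.
Let l1 : l <= 1. Proof. by case/andP: l01. Qed.
Let M0 : 0 < M. Proof. exact: lt_le_trans M1. Qed.
Let x1 : 1 <= x. Proof. by rewrite /x lerDl ltW. Qed.
Let x0 : 0 < x. Proof. exact: lt_le_trans x1. Qed.
Let ZW : Z <= W%:R.
Proof. by rewrite WE -[X in X <= _]expr1 ler_weXn2l //; case: s_arith. Qed.
Let W0 : 0 < W%:R :> R. Proof. exact: lt_le_trans ZW. Qed.
Let WY : W%:R <= Y%:R :> R.
Proof. by rewrite WE YE ler_weXn2l // leq_pred. Qed.
Let Y1 : 1 <= Y%:R :> R. Proof. by rewrite YE exprn_ege1. Qed.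
Let delta0 : 0 < delta.
Proof. by rewrite invr_gt0 mulr_gt0 // exprn_gt0 // (lt_le_trans _ Y1). Qed.
Let pi2 : 2 <= pi :> R := pi_ge2 R.
Let pi4 : pi <= 4 :> R. Proof. by have := pihalf_lt2 R; lra. Qed.

Let q_large q : q \in Q -> [/\ (0 < q)%N, W%:R <= q%:R :> R & 8 <= q%:R * l].
Proof.
move=> /hQ /and3P[pq Wq _]; have Wq' : W%:R <= q%:R :> R by rewrite ler_nat ltnW.
split; [exact: prime_gt0 | by [] |].
by rewrite -ler_pdivrMr //; apply: le_trans Wq'; apply: le_trans ZW.
Qed.

(** Here the sum approximates the integral with error at most [20 * x / (W * l)]. As
    [x^2 <= sqrt W], this is at most [e / x] once [K1] holds. *)
Lemma node_estimate_low : x ^+ 4 <= W%:R ->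
  `|sinc (pi * eta * delta) * node_sum Q u l eta th
     - sinc (pi * eta * l) * cos (2 * pi * eta * u + th)| <= e * x `^ rate R s.
Proof.
move=> xW; set A := node_sum _ _ _ _ _; set J := _ * cos _.
have A1 : `|A| <= 1 by exact: node_sum_le1.
have hA : `|A - J| <= 16 * x / (W%:R * l).
  apply: node_low => //; first by rewrite szQ -(ltr0n R).
  by move=> q /q_large [-> -> ->].
have d1 : delta <= W%:R^-1.
  rewrite lef_pV2 ?posrE // ?mulr_gt0 // ?exprn_gt0 ?(lt_le_trans _ Y1) //.
  apply: le_trans WY _; rewrite -[X in X <= _]mul1r; apply: ler_pM => //.
  by rewrite -[X in X <= _]expr1 ler_weXn2l.
have hs : `|sinc (pi * eta * delta) - 1| <= 4 * x / W%:R.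
  apply: le_trans (sinc_sub1 _) _; first by rewrite !mulr_gt0 // pi_gt0.
  apply: ler_pM => //; rewrite ?mulr_ge0 ?(ltW delta0) ?(ltW eta0) ?pi_ge0 //.
  by apply: ler_pM; rewrite ?pi_ge0 ?(ltW eta0) // /x; lra.
have tot : `|sinc (pi * eta * delta) * A - J| <= 20 * x / (W%:R * l).
  have -> : sinc (pi * eta * delta) * A - J = (sinc (pi * eta * delta) - 1) * A + (A - J) by ring.
  apply: le_trans (ler_normD _ _) _; rewrite normrM.
  have : `|sinc (pi * eta * delta) - 1| * `|A| <= 4 * x / W%:R * 1 by apply: ler_pM.
  have : 4 * x / W%:R * 1 <= 4 * x / (W%:R * l).
    rewrite mulr1 ler_wpM2l ?mulr_ge0 ?(ltW x0) // lef_pV2 ?posrE ?mulr_gt0 //.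
    by rewrite ler_piMr // ltW.
  have -> : 20 * x / (W%:R * l) = 4 * x / (W%:R * l) + 16 * x / (W%:R * l) by ring.
  lra.
apply: le_trans tot _.
apply: le_trans (_ : e * x^-1 <= _); last by rewrite ler_pM2l // rate_ge_inv.
rewrite ler_pdivrMr ?mulr_gt0 // mulrAC ler_pdivlMr //.
rewrite -ler_sqr ?nnegrE ?mulr_ge0 ?(ltW x0) ?(ltW e0) ?(ltW W0) ?(ltW l0) //.
have el : 0 < (e * l) ^+ 2 by rewrite exprn_gt0 ?mulr_gt0.
move: K1; rewrite ler_pdivrMr // => K1'.
apply: le_trans (_ : 20 ^+ 2 * W%:R <= _); first by apply: le_trans (_ : 20 ^+ 2 * x ^+ 4 <= _); [rewrite -mulrA exprMn -[x * x]expr2 -exprM | rewrite ler_pM2l // exprn_gt0].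
have -> : (e * (W%:R * l)) ^+ 2 = (W%:R * (e * l) ^+ 2) * W%:R by ring.
by rewrite ler_pM2r //; apply: le_trans K1' _; rewrite ler_pM2r.
Qed.

Section high.
Hypothesis xW : W%:R < x ^+ 4.

Let x2 : 2 <= x.
Proof.
have : 2 ^+ 4 <= x ^+ 4.
  by apply: ltW; apply: le_lt_trans xW; apply: le_trans ZW; move: K3; rewrite -natrX.
by rewrite ler_pXn2r // nnegrE ltW.
Qed.

Let pieta : x <= pi * eta.
Proof. by move: x2 pi2 eta0; rewrite /x => *; nra. Qed.

Let sx0 : 0 < Num.sqrt x. Proof. by rewrite sqrtr_gt0. Qed.

Let xsx : x = Num.sqrt x * Num.sqrt x.
Proof. by rewrite -expr2 sqr_sqrtr // ltW. Qed.

(** The bound [1 / x] beats the target by a factor [sqrt x], which absorbs any constant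
    [c <= sqrt x]. The share [e / 3] reflects the three terms to be bounded at high frequency. *)
Let share c : 0 <= c -> c ^+ 2 <= x -> 1 / x * (e / 3 * c) <= e / 3 * x `^ rate R s.
Proof.
move=> c0 cx; apply: le_trans (_ : e / 3 * (Num.sqrt x)^-1 <= _); last first.
  by rewrite ler_pM2l ?divr_gt0 // rate_ge_sqrt.
have cs : c <= Num.sqrt x by rewrite -(ger0_norm c0) -sqrtr_sqr ler_wsqrtr.
rewrite mulrCA ler_pM2l ?divr_gt0 // {1}xsx mul1r invfM -mulrA ler_piMr ?invr_ge0 ?(ltW sx0) //.
by rewrite mulrC ler_pdivrMr // mul1r.
Qed.

Let B_le_x : (12 / (l * e)) ^+ 2 <= x.
Proof.
rewrite -(@ler_pXn2r _ 4) ?nnegrE ?(ltW x0) ?exprn_ge0 ?divr_ge0 ?mulr_ge0 ?(ltW l0) ?(ltW e0) //.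
by apply: le_trans K2 _; apply: le_trans ZW _; exact: ltW.
Qed.

Let four_inv : 4 / (l * x) <= e / 3 * x `^ rate R s.
Proof.
apply: le_trans (share _ B_le_x); last by rewrite divr_ge0 ?mulr_ge0 ?(ltW l0) ?(ltW e0).
by apply: le_of_eq; field; rewrite !gt_eqF.
Qed.

Lemma node_estimate_high_main :
  `|sinc (pi * eta * l) * cos (2 * pi * eta * u + th)| <= e / 3 * x `^ rate R s.
Proof.
apply: le_trans four_inv; rewrite normrM.
apply: le_trans (_ : `|sinc (pi * eta * l)| * 1 <= _); first by rewrite ler_wpM2l // cos_max.
rewrite mulr1; apply: le_trans (sinc_le_inv _) _; first by rewrite !mulr_gt0 // pi_gt0.
apply: le_trans (_ : 1 / (l * x) <= _); last first.
  by rewrite ler_wpM2r ?invr_ge0 ?mulr_ge0 ?(ltW l0) ?(ltW x0) // ler1n.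
by rewrite div1r lef_pV2 ?posrE ?mulr_gt0 ?pi_gt0 // (mulrC l) ler_pM2r.
Qed.

Lemma sinc_delta_le : `|sinc (pi * eta * delta)| <= M * (Z ^+ s) ^+ 4 / x.
Proof.
apply: le_trans (sinc_le_inv _) _; first by rewrite !mulr_gt0 // pi_gt0.
rewrite invfM /delta invrK mulrC YE ler_pM2l; last by rewrite mulr_gt0 ?exprn_gt0 // exprn_gt0.
by rewrite lef_pV2 ?posrE // mulr_gt0 // pi_gt0.
Qed.

(** The averaging over the child intervals suffices alone: its factor is at most [M * Y^4 / x]. The
    exponent [12] is such that [8s + 1 <= 12 (s - 1)], so [Z * Y^8 <= W^12 < x] and [share]
    applies. *)
Lemma node_estimate_very_high : W%:R ^+ 12 < x ->
  `|sinc (pi * eta * delta) * node_sum Q u l eta th| <= e / 3 * x `^ rate R s.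
Proof.
move=> xW12; rewrite normrM.
apply: le_trans (_ : `|sinc (pi * eta * delta)| * 1 <= _).
  by rewrite ler_wpM2l // node_sum_le1.
rewrite mulr1; apply: le_trans sinc_delta_le _.
apply: le_trans (share (c := 3 * M / e * (Z ^+ s) ^+ 4) _ _).
- by apply: le_of_eq; field; rewrite !gt_eqF.
- apply: mulr_ge0; first by rewrite divr_ge0 // ?mulr_ge0 // ltW.
  by rewrite !exprn_ge0 // ltW.
rewrite exprMn; apply: le_trans (ltW xW12).
apply: le_trans (_ : Z * ((Z ^+ s) ^+ 4) ^+ 2 <= _).
  by rewrite ler_wpM2r ?sqr_ge0.
by rewrite WE -!exprM -exprS ler_weXn2l // ?mulnA; case: s_arith.
Qed.

Lemma node_sum_le_mid : x <= W%:R ^+ 12 ->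
  `|node_sum Q u l eta th| <= 2 / (l * eta) + 156 * (t * s + 2)%:R / (l * W%:R).
Proof.
move=> xW12.
have tr := @truncn_itv R eta (ltW eta0).
have Wn0 : (0 < W)%N by rewrite -(ltr0n R).
(* Both [eta] and [2 * Y] are at most [W^12], so [sum_run_le] applies with [K = 13]; the constant
   [156] is [6 * 2 * 13]. *)
have hK : (Num.truncn eta + 2 ^ (t * s).+1 < W ^ 13)%N.
  rewrite -(ltr_nat R) natrD expnS natrM -Y2 natrX.
  have h1 : 2 * Y%:R <= W%:R ^+ 12 :> R.
    apply: le_trans (_ : Z * Y%:R <= _).
      by rewrite ler_pM2r ?(lt_le_trans _ Y1) //; move: K3; lra.
    by rewrite YE WE -exprS -exprM ler_weXn2l //; case: s_arith.
  have h2 : (Num.truncn eta)%:R <= W%:R ^+ 12 :> R.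
    by apply: le_trans xW12; rewrite /x; lra.
  have h3 : 0 < W%:R ^+ 12 :> R by rewrite exprn_gt0.
  have h4 : 16 * W%:R ^+ 12 <= W%:R ^+ 13 :> R.
    by rewrite [X in _ <= X]exprS ler_pM2r //; apply: le_trans ZW.
  lra.
have hm : {in Q, forall q, q%:R * l / 2 <= (p_count q l)%:R}.
  by move=> q /q_large [_ _ /p_countP[]].
have YY : (Y <= 2 ^ (t * s))%N by rewrite Y2.
have := @sum_run_le R Q W Y (t * s) (fun q => p_start q u l) (fun q => p_count q l)
   eta th l uQ hQ Wn0 YY l01 hm eta0 13 hK.
rewrite szQ => H.
rewrite /node_sum szQ normrM gtr0_norm ?invr_gt0 // mulrC ler_pdivrMr //.
apply: le_trans H _; rewrite addn2; apply: le_of_eq.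
have -> : (2 * 13)%:R = 26 :> R by [].
by field; rewrite !gt_eqF.
Qed.

(** Interpolating between [|sinc| <= 1] and [|sinc| <= M * Y^4 / x] with exponent [- rate] treats
    frequencies below and above [Y^4] together. The result [M * Z^(s-4) * x^rate], multiplied by a
    logarithm over [W = Z^(s-4) * Z^3], is within the target. *)
Lemma node_estimate_mid : x <= W%:R ^+ 12 ->
  `|sinc (pi * eta * delta) * node_sum Q u l eta th| <= e / 3 * x `^ rate R s + e / 3 * x `^ rate R s.
Proof.
move=> xW12; rewrite normrM.
apply: le_trans (_ : `|sinc (pi * eta * delta)| * (2 / (l * eta) + 156 * (t * s + 2)%:R / (l * W%:R)) <= _).
  by rewrite ler_wpM2l // node_sum_le_mid.
rewrite mulrDr; apply: lerD.
  apply: le_trans four_inv.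
  apply: le_trans (_ : 1 * (2 / (l * eta)) <= _).
    by rewrite ler_wpM2r ?sinc_le1 // divr_ge0 // mulr_ge0 ?ltW.
  rewrite mul1r ler_pdivrMr ?mulr_gt0 //.
  have -> : 4 / (l * x) * (l * eta) = 4 * eta / x by field; rewrite !gt_eqF.
  by rewrite ler_pdivlMr //; move: x2; rewrite /x; lra.
set D := 156 * _ / _.
have D0 : 0 <= D by rewrite divr_ge0 ?mulr_ge0 // ltW.
have Y4 : 0 < M * (Z ^+ s) ^+ 4 / x by rewrite divr_gt0 // mulr_gt0 // !exprn_gt0.
have r01 : 0 <= - rate R s <= 1.
  rewrite /rate; have : 0 <= s%:R^-1 :> R by [].
  have : s%:R^-1 <= 5^-1 :> R by rewrite lef_pV2 ?posrE ?ltr0n ?ler_nat //; case: s_arith.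
  lra.
have := norm_le_powR (sinc_le1 _) Y4 sinc_delta_le r01.
move=> /le_trans /(_ (powR_scale s5 x1 Z1 M1)) => H.
apply: le_trans (ler_wpM2r D0 H) _.
rewrite mulrAC ler_wpM2r ?powR_ge0 //.
have Wz : W%:R = Z ^+ (s - 4) * Z ^+ 3 by rewrite WE -exprD; case: s_arith => _ _ _ _ <-.
have tsZ : (t * s + 2)%:R <= (s + 2)%:R * Z.
  rewrite !natrD natrM mulrDl mulrC; apply: lerD; first by rewrite ler_wpM2l.
  by move: Z1; lra.
rewrite /D Wz [_ * (_ / _)]mulrA ler_pdivrMr ?mulr_gt0 ?exprn_gt0 //.
have Zs : 0 < Z ^+ (s - 4) by rewrite exprn_gt0.
have -> : e / 3 * (l * (Z ^+ (s - 4) * Z ^+ 3)) = Z ^+ (s - 4) * (e * l * Z ^+ 3 / 3) by ring.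
have -> : M * Z ^+ (s - 4) * (156 * (t * s + 2)%:R) =
    Z ^+ (s - 4) * (M * (156 * (t * s + 2)%:R)) by rewrite [RHS]mulrA (mulrC _ M).
rewrite ler_pM2l //.
have el : 0 < e * l by rewrite mulr_gt0.
move: K5; rewrite ler_pdivrMr // => K5'.
have h1 : M * (156 * (t * s + 2)%:R) <= M * (156 * ((s + 2)%:R * Z)).
  by rewrite ler_pM2l // ler_pM2l.
have h2 : 468 * (s + 2)%:R * M * Z <= Z * (e * l) * Z by rewrite ler_pM2r.
have h3 : Z * (e * l) * Z * 1 <= Z * (e * l) * Z * Z by rewrite ler_pM2l // !mulr_gt0.
have -> : e * l * Z ^+ 3 = Z * (e * l) * Z * Z by ring.
apply: le_trans h1 _; rewrite ler_pdivlMr //; apply: le_trans h3.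
by rewrite mulr1; apply: le_trans h2; apply: le_of_eq; ring.
Qed.

Lemma node_estimate_high :
  `|sinc (pi * eta * delta) * node_sum Q u l eta th
     - sinc (pi * eta * l) * cos (2 * pi * eta * u + th)| <= e * x `^ rate R s.
Proof.
apply: le_trans (ler_normB _ _) _.
have -> : e * x `^ rate R s = (e / 3 * x `^ rate R s + e / 3 * x `^ rate R s) + e / 3 * x `^ rate R s by field.
apply: lerD node_estimate_high_main.
have [h|h] := lerP x (W%:R ^+ 12); first exact: node_estimate_mid.
apply: le_trans (node_estimate_very_high h) _.
by rewrite lerDl mulr_ge0 ?powR_ge0 // divr_ge0 // ltW.
Qed.

End high.
End scale.

(** The left side is the change of the transform when an interval of length [l] around [u] is
    replaced by its children of length [1 / (M * Y^4)]. The threshold [T] is uniform in [u], [Q],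
    [eta] and [th], so one [t] serves all intervals of a layer. *)
Lemma node_estimate s l M e : (5 <= s)%N -> 0 < l <= 1 -> 1 <= M -> 0 < e ->
  exists T, forall t, (T <= t)%N ->
  let W := (2 ^ (t * s.-1))%N in let Y := (2 ^ (t * s))%N in
  forall u (Q : seq nat), l / 2 <= u -> uniq Q ->
  {in Q, forall q, [&& prime q, (W < q)%N & (q <= Y)%N]} -> size Q = W ->
  forall eta th, 0 < eta ->
  `|sinc (pi * eta * (M * Y%:R ^+ 4)^-1) * node_sum Q u l eta th
     - sinc (pi * eta * l) * cos (2 * pi * eta * u + th)| <= e * (1 + eta) `^ rate R s.
Proof.
move=> s5 l01 M1 e0; have /andP[l0 l1] := l01; have M0 : 0 < M by apply: lt_le_trans M1.
set k1 := 20 ^+ 2 / (e * l) ^+ 2; set k2 := ((12 / (l * e)) ^+ 2) ^+ 4.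
set k4 := (3 * M / e) ^+ 2; set k5 := 468 * (s + 2)%:R * M / (e * l); set k6 := 8 / l.
have g1 : 0 <= k1 by rewrite divr_ge0 ?exprn_ge0 // mulr_ge0 // ltW.
have g2 : 0 <= k2 by rewrite exprn_ge0 // exprn_ge0 // divr_ge0 // mulr_ge0 // ltW.
have g4 : 0 <= k4 by rewrite exprn_ge0 // divr_ge0 // ?mulr_ge0 // ltW.
have g5 : 0 <= k5.
  apply: divr_ge0; last by rewrite ltW // mulr_gt0.
  by apply: mulr_ge0 (ltW M0); apply: mulr_ge0; rewrite ler0n.
have g6 : 0 <= k6 by rewrite divr_ge0 // ltW.
exists (Num.truncn (k1 + k2 + 16 + k4 + k5 + k6)).+1 => t tT /=.
have kZ : k1 + k2 + 16 + k4 + k5 + k6 <= (2 ^ t)%:R.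
  set k := _ + k6 in tT *.
  have k0 : 0 <= k by rewrite /k; lra.
  have /andP[_ kt] := @truncn_itv R k k0.
  apply: ltW; apply: (lt_le_trans kt); rewrite ler_nat; apply: leq_trans tT _.
  exact/ltnW/ltn_expl.
move=> u Q lu uQ hQ szQ eta th eta0.
have tZ : t%:R <= (2 ^ t)%:R :> R by rewrite ler_nat; exact/ltnW/ltn_expl.
have WE : (2 ^ (t * s.-1))%:R = (2 ^ t)%:R ^+ s.-1 :> R by rewrite -natrX -expnM.
have YE : (2 ^ (t * s))%:R = (2 ^ t)%:R ^+ s :> R by rewrite -natrX -expnM.
move: (2 ^ t)%:R kZ tZ WE YE => Z kZ tZ WE YE.
have Y2 : (2 ^ (t * s) = 2 ^ (t * s))%N by [].
have [h|h] := lerP ((1 + eta) ^+ 4) (2 ^ (t * s.-1))%:R.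
  by apply: (node_estimate_low WE YE) => //; rewrite -?/k1 -?/k2 -?/k4 -?/k5 -?/k6; lra.
by apply: (node_estimate_high WE YE Y2 tZ) => //; rewrite -?/k1 -?/k2 -?/k4 -?/k5 -?/k6; lra.
Qed.

End node.

(** * Weak limits of nested finite measures *)

Section bounded_integrals.
Variables (R : realType) (P : probability (measurableTypeR R) R).
Implicit Types (f : R -> R) (B : R) (D : set (measurableTypeR R)).

Lemma bounded_integrable D f B : measurable D -> measurable_fun setT f ->
  (forall x, `|f x| <= B) -> P.-integrable D (EFin \o f).
Proof.
move=> mD mf fB; apply: measurable_bounded_integrable => //.
- by apply: le_lt_trans (probability_le1 P mD) _; rewrite ltry.
- exact: measurable_funTS.
- by exists B; split; [exact: num_real | move=> y By x _ /=; apply: le_trans (fB x) (ltW By)].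
Qed.

Lemma Rintegral_le_bound f B : measurable_fun setT f -> (forall x, `|f x| <= B) ->
  `|\int[P]_(x in setT) f x| <= B.
Proof.
move=> mf fB; have mT := @measurableT _ (measurableTypeR R).
have iB : P.-integrable setT (EFin \o (fun=> B)).
  by apply: (@bounded_integrable _ _ `|B|) => //.
apply: le_trans (le_normr_Rintegral mT (bounded_integrable mT mf fB)) _.
apply: le_trans (le_Rintegral mT _ iB (fun x _ => fB x)) _.
  apply: (@bounded_integrable _ _ B) => //; last by move=> x; rewrite normr_id.
  exact: measurableT_comp.
rewrite Rintegral_cst //; apply: le_of_eq; rewrite -[RHS]mulr1; congr (_ * _).
exact: (congr1 fine (probability_setT P)).
Qed.

End bounded_integrals.

(** * Step functions on the unit interval *)

Section step_functions.
Variable R : realType.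
Implicit Types (L : seq (R * R)) (s x : R) (h : R -> R).

Local Notation P := (uniform_prob (@ltr01 R)).

Lemma uniform01_itvco (a b : R) : 0 <= a -> a <= b -> b <= 1 -> P `[a, b[ = (b - a)%:E.
Proof.
move=> a0 ab b1; rewrite /uniform_prob.
rewrite (eq_integral (fun=> 1%E)); last first.
  move=> x; rewrite inE /= in_itv /= => /andP[ax xb]; rewrite /uniform_pdf.
  by rewrite (le_trans a0 ax) (le_trans (ltW xb) b1) subr0 invr1.
rewrite integral_cst //= mul1e lebesgue_measure_itv /= lte_fin.
by case: ltP => // ba; rewrite (@le_anti _ _ a b) ?ab // subrr.
Qed.

(* The pairs [(w, u)] of [L] are weights and values: the value [u] is taken on an
   interval of length [w], the first one starting at [s]. *)
Fixpoint step s L x : R :=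
  if L is a :: L' then if x < s + a.1 then a.2 else step (s + a.1) L' x else 0.

Lemma step_mem s L x : s <= x < s + \sum_(a <- L) a.1 ->
  exists2 a, a \in L & step s L x = a.2.
Proof.
elim: L s => [|a L IH] s /=; first by rewrite big_nil addr0 => h; exfalso; lra.
rewrite big_cons => sx; case: ltP => xa; first by exists a; rewrite ?mem_head.
have [|b bL ->] := IH (s + a.1); first by rewrite xa -addrA; case/andP: sx.
by exists b; rewrite // inE bL orbT.
Qed.

Lemma step_cat_l s L L' x : {in L, forall a, 0 <= a.1} -> s <= x < s + \sum_(a <- L) a.1 ->
  step s (L ++ L') x = step s L x.
Proof.
elim: L s => [|a L IH] s w0 /=; first by rewrite big_nil addr0 => h; exfalso; lra.
rewrite big_cons => sx; case: ltP => // xa; apply: IH.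
  by move=> b bL; apply: w0; rewrite inE bL orbT.
by rewrite xa -addrA; case/andP: sx.
Qed.

Lemma step_cat_r s L L' x : {in L, forall a, 0 <= a.1} -> s + \sum_(a <- L) a.1 <= x ->
  step s (L ++ L') x = step (s + \sum_(a <- L) a.1) L' x.
Proof.
elim: L s => [|a L IH] s w0 /=; first by rewrite big_nil addr0.
have w0' : {in L, forall a, 0 <= a.1} by move=> b bL; apply: w0; rewrite inE bL orbT.
rewrite big_cons addrA => sx; rewrite ltNge (le_trans _ sx) /= ?IH //.
rewrite lerDl big_seq; apply: sumr_ge0 => b; exact: w0'.
Qed.

Definition scaled (w : R) L := [seq (w * c.1, c.2) | c <- L].

Lemma sum_scaled w L : \sum_(c <- scaled w L) c.1 = w * \sum_(c <- L) c.1.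
Proof. by rewrite big_map mulr_sumr. Qed.

(* The weights of the children are relative to their parent. *)
Definition parents (K : seq ((R * R) * seq (R * R))) := [seq p.1 | p <- K].
Definition children (K : seq ((R * R) * seq (R * R))) :=
  flatten [seq scaled p.1.1 p.2 | p <- K].

(** The scaled children of a parent have total length equal to its own, so the finer partition of
    the interval subdivides the coarser one. *)
Lemma step_children s K x :
  {in K, forall p, 0 <= p.1.1 /\ {in p.2, forall c, 0 <= c.1}} ->
  {in K, forall p, \sum_(c <- p.2) c.1 = 1} ->
  s <= x < s + \sum_(p <- K) p.1.1 ->
  exists2 p, p \in K & step s (parents K) x = p.1.2 /\
    exists2 c, c \in p.2 & step s (children K) x = c.2.
Proof.
elim: K s => [|p K IH] s w0 s1 /=; first by rewrite big_nil addr0 => h; exfalso; lra.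
have [p0 c0] := w0 p (mem_head _ _); have p1 := s1 p (mem_head _ _).
have sc0 : {in scaled p.1.1 p.2, forall a, 0 <= a.1}.
  by move=> _ /mapP[c cp ->] /=; apply: mulr_ge0 => //; exact: c0.
have sc1 : \sum_(c <- scaled p.1.1 p.2) c.1 = p.1.1 by rewrite sum_scaled p1 mulr1.
rewrite big_cons => sx; rewrite /children /=; case: ltP => xa.
  have sx' : s <= x < s + \sum_(c <- scaled p.1.1 p.2) c.1 by rewrite sc1 xa; case/andP: sx => ->.
  exists p; rewrite ?mem_head //; split=> //; rewrite step_cat_l //.
  have [_ /mapP[c cp ->] ->] := step_mem sx'; by exists c.
have [|||q qK [-> [c cq E]]] := IH (s + p.1.1).
- by move=> r rK; apply: w0; rewrite inE rK orbT.
- by move=> r rK; apply: s1; rewrite inE rK orbT.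
- by rewrite xa -addrA; case/andP: sx.
exists q; first by rewrite inE qK orbT.
by split=> //; exists c => //; rewrite step_cat_r ?sc1 // -E.
Qed.

Lemma measurable_step s L : measurable_fun setT (step s L : measurableTypeR R -> R).
Proof.
elim: L s => [|a L IH] s /=; first exact: measurable_cst.
by apply: measurable_fun_ifT => //; exact: measurable_fun_ltr.
Qed.

Lemma step_integral s L h (B : R) : {in L, forall a, 0 <= a.1} -> 0 <= s ->
  s + \sum_(a <- L) a.1 <= 1 -> measurable_fun setT (h : measurableTypeR R -> R) ->
  (forall x, `|h x| <= B) ->
  \int[P]_(x in `[s, s + \sum_(a <- L) a.1[) h (step s L x) = \sum_(a <- L) a.1 * h a.2.
Proof.
move=> w0 s0 s1 mh hB; elim: L s w0 s0 s1 => [|a L IH] s w0 s0 s1.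
  by rewrite !big_nil addr0 set_itvco0 ?Rintegral_set0.
have a0 : 0 <= a.1 by apply: w0; rewrite mem_head.
have w0' : {in L, forall a, 0 <= a.1} by move=> b bL; apply: w0; rewrite inE bL orbT.
have S0 : 0 <= \sum_(a <- L) a.1 by rewrite big_seq; apply: sumr_ge0 => b; exact: w0'.
rewrite !big_cons in s1 *; rewrite addrA in s1 *.
have split_itv : `[s, s + a.1 + \sum_(j <- L) j.1[%classic =
    `[s, s + a.1[ `|` `[s + a.1, s + a.1 + \sum_(j <- L) j.1[ :> set R.
  apply/seteqP; split=> x /=; rewrite !in_itv /=.
    move=> /andP[h1 h2]; case: (ltP x (s + a.1)) => h3; [left | right].
      by rewrite h1.
    by rewrite h2.
  by case=> /andP[xs sx]; apply/andP; split; lra.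
rewrite split_itv Rintegral_setU //=; last 2 first.
- apply: (@bounded_integrable _ P _ _ B); first exact: measurableU.
    apply: measurableT_comp => //; exact: (@measurable_step s (a :: L)).
  by move=> x; exact: hB.
- apply/disj_setPS => x [] /=; rewrite !in_itv /= => /andP[_ xa] /andP[ax _].
  by rewrite ltNge ax in xa.
congr (_ + _).
  rewrite (@eq_Rintegral _ _ _ _ _ (fun=> h a.2)); last first.
    by move=> x; rewrite inE /= in_itv /= => /andP[_ ->].
  rewrite Rintegral_cst // mulrC; congr (_ * _).
  transitivity (fine ((s + a.1) - s)%:E); last by rewrite /= addrAC subrr add0r.
  by congr fine; apply: uniform01_itvco; rewrite ?lerDl //; lra.
rewrite -(IH (s + a.1)) //; last by rewrite addr_ge0.
apply: eq_Rintegral => x; rewrite inE /= in_itv /= => /andP[ax _].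
by rewrite ltNge ax.
Qed.

(** [step] is controlled on [[0, 1[] only; the rest is null for the uniform measure and is sent to
    [0]. *)
Definition clamp x : R := if 0 <= x < 1 then x else 0.

Lemma clamp_itv x : 0 <= clamp x < 1.
Proof. by rewrite /clamp; case: ifP => //; rewrite lexx ltr01. Qed.

Lemma measurable_clamp : measurable_fun setT (clamp : measurableTypeR R -> R).
Proof.
apply: measurable_fun_ifT => //; apply: measurable_and.
  exact: measurable_fun_ler.
exact: measurable_fun_ltr.
Qed.

Lemma step_integralT L h (B : R) : {in L, forall a, 0 <= a.1} ->
  \sum_(a <- L) a.1 = 1 -> measurable_fun setT (h : measurableTypeR R -> R) ->
  (forall x, `|h x| <= B) ->
  \int[P]_(x in setT) h (step 0 L (clamp x)) = \sum_(a <- L) a.1 * h a.2.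
Proof.
move=> w0 w1 mh hB.
have mf : measurable_fun setT (fun x : measurableTypeR R => h (step 0 L (clamp x))).
  apply: measurableT_comp => //; apply: measurableT_comp; first exact: measurable_step.
  exact: measurable_clamp.
have mI : measurable (`[0, 1[ : set (measurableTypeR R)) by exact: measurable_itv.
rewrite -(setUv `[0, 1[%classic) Rintegral_setU //=; last 3 first.
- exact: measurableC.
- rewrite setUv.
  apply: (@bounded_integrable _ P setT _ B measurableT mf (fun x => hB _)).
- by apply/disj_setPS => x [].
rewrite [X in _ + X](_ : _ = 0) ?addr0; last first.
  rewrite /Rintegral null_set_integral //; first exact: measurableC.
    by apply/measurable_EFinP; exact: measurable_funTS.
  have I1 : P `[0, 1[%classic = 1%E by rewrite uniform01_itvco ?ler01 // subr0.
  by apply: etrans (probability_setC P mI) _; rewrite [X in (1 - X)%E]I1 subee.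
have E : `[0, 1[%classic = `[0, 0 + \sum_(a <- L) a.1[%classic :> set R by rewrite w1 add0r.
rewrite -(step_integral w0 (lexx 0) _ mh hB) -?E ?w1 ?add0r //.
apply: eq_Rintegral => x; rewrite inE /= in_itv /= => x01.
by rewrite /clamp x01.
Qed.

End step_functions.

(** * The limit of the step functions and its law *)

Section limit.
Variable R : realType.

Definition cover (L : nat -> seq (R * R)) (l : nat -> R) : set (measurableTypeR R) :=
  [set x | forall n, exists2 a, a \in L n & `|x - a.2| <= l n / 2].

Lemma cover_seqE (L : seq (R * R)) (l : R) :
  [set x : R | exists2 a, a \in L & `|x - a.2| <= l / 2] =
  \big[setU/set0]_(a <- L) `[a.2 - l / 2, a.2 + l / 2]%classic.
Proof.
rewrite -bigcup_seq; apply/seteqP; split=> x /=.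
  by case=> a aL xa; exists a => //=; rewrite in_itv /=; move: xa; rewrite ler_norml; lra.
by case=> a /= aL; rewrite in_itv /= => xa; exists a => //; rewrite ler_norml; lra.
Qed.

Lemma measurable_cover L l : measurable (cover L l).
Proof.
rewrite (_ : cover L l = \bigcap_n [set x : R | exists2 a, a \in L n & `|x - a.2| <= l n / 2]).
  by apply: bigcap_measurableType => n _; rewrite cover_seqE; apply: bigsetU_measurable.
by apply/seteqP; split=> x /= H n; [move=> _|]; exact: H.
Qed.

Lemma measurable_cos_affine (xi th : R) :
  measurable_fun setT (fun x : measurableTypeR R => cos (xi * x + th)).
Proof.
apply: (@measurableT_comp _ _ _ _ _ _ cos).
  by apply: continuous_measurable_fun; exact: continuous_cos.
by apply: measurable_funD => //; exact: measurable_funM.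
Qed.

Local Notation P := (uniform_prob (@ltr01 R)).

Section limit_measure.
Variables (L : nat -> seq (R * R)) (l : nat -> R).
Hypothesis w0 : forall n, {in L n, forall a, 0 <= a.1}.
Hypothesis w1 : forall n, \sum_(a <- L n) a.1 = 1.
Hypothesis nest : forall n x, 0 <= x < 1 ->
  `|step 0 (L n.+1) x - step 0 (L n) x| <= (l n - l n.+1) / 2.
Hypothesis l0 : forall n, 0 <= l n.

Let S n x := step 0 (L n) (clamp x).

Lemma S_dist n k x : `|S (n + k) x - S n x| <= (l n - l (n + k)) / 2.
Proof.
elim: k => [|k IH]; first by rewrite addn0 !subrr normr0 mul0r.
rewrite addnS; have := nest (n + k) (clamp_itv x); rewrite -!/(S _ _) => H.
have -> : S (n + k).+1 x - S n x = (S (n + k).+1 x - S (n + k) x) + (S (n + k) x - S n x) by ring.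
by apply: le_trans (ler_normD _ _) _; lra.
Qed.

(** The supremum of the left ends of the intervals of length [l n] around [S n x]. Any left end is
    below any right end, so [X x] lies in all these intervals, and it is measurable as a supremum of
    a sequence. *)
Let X x : R := sups (fun n => S n x - l n / 2) 0.

Lemma S_bound m n x : S m x - l m / 2 <= S n x + l n / 2.
Proof.
have [mn|nm] := leqP m n.
  have := S_dist m (n - m) x; rewrite subnKC // ler_norml; have := l0 n; have := l0 m; lra.
have := S_dist n (m - n) x; rewrite subnKC ?(ltnW nm) // ler_norml; have := l0 n; have := l0 m; lra.
Qed.

Lemma has_ubound_S x : has_ubound (range (fun n => S n x - l n / 2)).
Proof. by exists (S 0 x + l 0 / 2) => _ [n _ <-]; exact: S_bound. Qed.

Lemma X_dist n x : `|X x - S n x| <= l n / 2.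
Proof.
have lo : S n x - l n / 2 <= X x.
  rewrite /X /sups; apply: ub_le_sup; last by exists n.
  by case: (has_ubound_S x) => B hB; exists B => _ [m _ <-]; apply: hB; exists m.
have hi : X x <= S n x + l n / 2.
  rewrite /X /sups; apply: ge_sup; first by exists (S 0 x - l 0 / 2), 0%N.
  by move=> _ [m _ <-]; exact: S_bound.
by rewrite ler_norml; lra.
Qed.

Lemma measurable_S n : measurable_fun setT (S n : measurableTypeR R -> R).
Proof. by apply: measurableT_comp; [exact: measurable_step | exact: measurable_clamp]. Qed.

Lemma measurable_X : measurable_fun setT (X : measurableTypeR R -> R).
Proof.
apply: measurable_fun_sups; first by move=> x _; exact: has_ubound_S.
by move=> n; apply: measurable_funB => //; exact: measurable_S.
Qed.

(** The [n]-th discrete measure is the law of [S n] under the uniform measure, and [mu] is the law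
    of [X]. The single estimate [X_dist] gives both the support and the error for cosines. *)
Lemma limit_measure : exists mu : probability (measurableTypeR R) R,
  mu (cover L l) = 1%E /\
  forall n xi th, `|\int[mu]_(x in setT) cos (xi * x + th) -
      \sum_(a <- L n) a.1 * cos (xi * a.2 + th)| <= `|xi| * (l n / 2).
Proof.
pose XM : {mfun measurableTypeR R >-> measurableTypeR R} :=
  MeasurableFun.Pack (MeasurableFun.Class (isMeasurableFun.Build _ _ (measurableTypeR R) (measurableTypeR R) X measurable_X)).
exists (distribution P XM); split.
  suff XT : X @^-1` cover L l = setT by apply: etrans (probability_setT P); rewrite -XT.
  apply/seteqP; split=> // x _ /= n.
  have [|a aL E] := @step_mem _ 0 (L n) (clamp x); first by rewrite w1 add0r clamp_itv.
  by exists a => //; rewrite -E; exact: X_dist.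
move=> n xi th.
have mc := measurable_cos_affine xi th.
have mX : measurable_fun setT (fun x : measurableTypeR R => cos (xi * X x + th)).
  exact: (measurableT_comp mc measurable_X).
have mS : measurable_fun setT (fun x : measurableTypeR R => cos (xi * S n x + th)).
  exact: (measurableT_comp mc (measurable_S n)).
have iX := @bounded_integrable _ P setT _ 1 measurableT mX (fun x => cos_max _).
have iS := @bounded_integrable _ P setT _ 1 measurableT mS (fun x => cos_max _).
have -> : \int[distribution P XM]_(x in setT) cos (xi * x + th) =
    \int[P]_(x in setT) cos (xi * X x + th).
  rewrite /Rintegral (@integral_distribution _ _ _ _ _ P XM) //.
  exact/measurable_EFinP.
rewrite -(step_integralT (@w0 n) (w1 n) mc (fun x => cos_max _)) -RintegralB //.
apply: Rintegral_le_bound; first exact: measurable_funB.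
move=> x; apply: le_trans (cos_lip _ _) _.
have -> : xi * X x + th - (xi * step 0 (L n) (clamp x) + th) = xi * (X x - S n x).
  by rewrite /S; ring.
by rewrite normrM ler_wpM2l // X_dist.
Qed.

End limit_measure.
End limit.

(** * The tower of intervals *)

Section stages.
Variable R : realType.

(* [(w, (p, q))] is an interval of weight [w] centred at [p / q]. *)
Definition node := (R * (nat * nat))%type.
Definition centre (a : node) : R := a.2.1%:R / a.2.2%:R.
Definition point (a : node) : R * R := (a.1, centre a).
Definition points (N : seq node) : seq (R * R) := [seq point a | a <- N].

(* The factor [sinc] turns the value of the cosine at a centre into its average
   over the interval of length [l] around it. *)
Definition layer_cos (N : seq node) (l eta th : R) : R :=
  sinc (pi * eta * l) * \sum_(a <- N) a.1 * cos (2 * pi * eta * centre a + th).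

Definition kids (a : node) (l : R) (Q : seq nat) : seq node :=
  flatten [seq [seq (((size Q)%:R * (p_count q l)%:R)^-1, ((p_start q (centre a) l + r)%N, q))
               | r <- iota 0 (p_count q l)] | q <- Q].

(** Successive intervals receive successive blocks of [W] entries of [P]. For duplicate-free [P] the
    blocks are disjoint, so a prime determines its parent interval. *)
Fixpoint attach (l : R) (W : nat) (N : seq node) (P : seq nat) : seq (node * seq node) :=
  if N is a :: N' then (a, kids a l (take W P)) :: attach l W N' (drop W P) else [::].

Definition refine (K : seq (node * seq node)) : seq node :=
  flatten [seq [seq (p.1.1 * c.1, c.2) | c <- p.2] | p <- K].

(** Keeping the intervals in [[1/4, 3/4]] forces the numerators of the centres strictly between [0]
    and the denominators. *)
Definition valid (N : seq node) (l : R) :=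
  [/\ 0 < l <= 1, {in N, forall a, 0 <= a.1}, \sum_(a <- N) a.1 = 1
    & {in N, forall a, 1 / 4 + l / 2 <= centre a <= 3 / 4 - l / 2}].

(* With [s = n + 5] and [Z = 2 ^ t], the new denominators are primes in
   [(Z ^ (s - 1), Z ^ s]], and no prime is used inside two different intervals of [N]. *)
Definition refines (M : R) (n : nat) (N : seq node) (l : R) (N' : seq node) (l' : R) :=
  [/\ forall x, 0 <= x < 1 ->
        `|step 0 (points N') x - step 0 (points N) x| <= (l - l') / 2,
      forall eta th, 0 < eta ->
        `|layer_cos N' l' eta th - layer_cos N l eta th|
           <= (1 / 2) ^+ n * (1 + eta) `^ rate R (n + 5)
    & exists2 t, (n <= t)%N &
        [/\ l' = (M * (2 ^ (t * (n + 5)))%:R ^+ 4)^-1,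
            {in N', forall a, [/\ prime a.2.2, (2 ^ (t * (n + 4)) < a.2.2 <= 2 ^ (t * (n + 5)))%N
               & (0 < a.2.1 < a.2.2)%N]}
          & {in N' &, forall a b, a.2.2 = b.2.2 -> `|centre a - centre b| <= l}]].

Lemma mem_kids a l Q c : c \in kids a l Q -> exists q r,
  [/\ q \in Q, (r < p_count q l)%N &
   c = (((size Q)%:R * (p_count q l)%:R)^-1, ((p_start q (centre a) l + r)%N, q))].
Proof.
case/flattenP => _ /mapP[q qQ ->] /mapP[r]; rewrite mem_iota add0n => /= rm ->.
by exists q, r.
Qed.

Lemma sum_kids a l Q (f : nat -> nat -> R) :
  \sum_(c <- kids a l Q) c.1 * f c.2.1 c.2.2 =
  (size Q)%:R^-1 * \sum_(q <- Q) (p_count q l)%:R^-1 *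
     \sum_(r < p_count q l) f (p_start q (centre a) l + r)%N q.
Proof.
rewrite big_flatten big_map mulr_sumr; apply: eq_bigr => q _.
rewrite big_map /= -(big_mkord xpredT (fun r => f (p_start q (centre a) l + r)%N q)).
rewrite /index_iota subn0 mulrA mulr_sumr; apply: eq_bigr => r _.
by rewrite invfM.
Qed.

Lemma sum_kids_cos a l Q eta th :
  \sum_(c <- kids a l Q) c.1 * cos (2 * pi * eta * centre c + th) =
  node_sum Q (centre a) l eta th.
Proof.
rewrite /centre (sum_kids a l Q (fun p q => cos (2 * pi * eta * (p%:R / q%:R) + th))).
by [].
Qed.

Lemma sum_kids_weight a l Q : (0 < size Q)%N -> {in Q, forall q, (0 < p_count q l)%N} ->
  \sum_(c <- kids a l Q) c.1 = 1.
Proof.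
move=> Q0 m0; under eq_bigr do rewrite -[_.1]mulr1.
rewrite (sum_kids a l Q (fun _ _ => 1)) big_seq.
under eq_bigr => q qQ.
  rewrite sumr_const card_ord -[1 *+ _]mulr_natr mul1r mulVf; last first.
    by rewrite pnatr_eq0 -lt0n m0.
  over.
rewrite -big_seq big_const_seq count_predT iter_addr_0 -mulr_natr mul1r mulVf //.
by rewrite pnatr_eq0 -lt0n.
Qed.

Lemma attachP l W N P : uniq P -> (size N * W <= size P)%N ->
  {in attach l W N P, forall k, k.1 \in N /\ exists2 Q : seq nat,
     [/\ uniq Q, size Q = W & {subset Q <= P}] & k.2 = kids k.1 l Q}.
Proof.
elim: N P => [|a N IH] P uP; first by move=> _ k.
rewrite mulSn => sP k; rewrite inE => /predU1P[->|kK] /=.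
  split; first exact: mem_head.
  exists (take W P) => //; split; first exact: take_uniq.
    rewrite size_takel //; exact: leq_trans (leq_addr _ _) sP.
  by move=> q /mem_take.
have [||kN [Q [uQ sQ QP] ->]] := IH (drop W P) _ _ k kK.
- exact: drop_uniq.
- by rewrite size_drop leq_subRL ?(leq_trans (leq_addr _ _) sP).
split; first by rewrite inE kN orbT.
by exists Q => //; split=> // q /QP /mem_drop.
Qed.

Lemma attach_mem_prime l W N P : {in attach l W N P, forall k, {in k.2, forall c, c.2.2 \in P}}.
Proof.
elim: N P => [|a N IH] P k //=; rewrite inE => /predU1P[->|kK] c /=.
  by case/mem_kids => q [r [qQ _ ->]] /=; exact: mem_take qQ.
by move=> /(IH _ _ kK) /mem_drop.
Qed.

Lemma attach_inj l W N P : uniq P ->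
  {in attach l W N P &, forall k k', forall c d, c \in k.2 -> d \in k'.2 ->
     c.2.2 = d.2.2 -> k = k'}.
Proof.
elim: N P => [|a N IH] P uP k k' //=.
have disj q : q \in take W P -> q \in drop W P -> False.
  move=> q1 q2; move: uP; rewrite -{1}(cat_take_drop W P) cat_uniq => /and3P[_ /hasPn h _].
  by have := h q q2; rewrite q1.
have hd c : c \in kids a l (take W P) -> c.2.2 \in take W P.
  by case/mem_kids => q [r [qQ _ ->]].
rewrite !inE => /predU1P[->|kK] /predU1P[->|kK'] c d //= ck dk' E.
- by case: (disj c.2.2 (hd _ ck)); rewrite E; exact: (attach_mem_prime kK').
- by case: (disj d.2.2 (hd _ dk')); rewrite -E; exact: (attach_mem_prime kK).
- exact: (IH _ (drop_uniq _ uP) k k' kK kK' c d).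
Qed.

Lemma attach_parents l W N P : [seq k.1 | k <- attach l W N P] = N.
Proof. by elim: N P => [|a N IH] P //=; rewrite IH. Qed.

Definition pointsK (K : seq (node * seq node)) :=
  [seq (point k.1, [seq point c | c <- k.2]) | k <- K].

Lemma parents_pointsK K : parents (pointsK K) = points [seq k.1 | k <- K].
Proof. by rewrite /parents /pointsK /points -!map_comp. Qed.

Lemma children_pointsK K : children (pointsK K) = points (refine K).
Proof.
rewrite /children /pointsK /points /refine map_flatten -!map_comp; congr flatten.
by apply: eq_map => k /=; rewrite /scaled -!map_comp; apply: eq_map.
Qed.

Lemma mem_refine K c : c \in refine K ->
  exists2 k, k \in K & exists2 d, d \in k.2 & c = (k.1.1 * d.1, d.2).
Proof. by case/flattenP => _ /mapP[k kK ->] /mapP[d dk ->]; exists k => //; exists d. Qed.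

End stages.

(** * Construction of the next layer *)

Section next.
Variable R : realType.

(** The slack [1 / q] comes from the offsets in [p_start] and [p_count]; since the child length is
    at most [1 / q], the child interval stays inside its parent. *)
Lemma kid_inside (a : node R) l Q c : 0 < l -> l / 2 <= centre a ->
  {in Q, forall q, (0 < q)%N && (8 <= q%:R * l)} -> c \in kids a l Q ->
  `|centre c - centre a| <= l / 2 - (c.2.2)%:R^-1.
Proof.
move=> l0 la hQ /mem_kids[q [r [qQ rm ->]]]; rewrite {1}/centre /=.
have /andP[q0 q8] := hQ q qQ; have q0R : 0 < q%:R :> R by rewrite ltr0n.
have lo : 0 <= q%:R * (centre a - l / 2) by rewrite mulr_ge0 ?subr_ge0 // ltW.
have := p_startP lo; have [_ c2 c0 _] := p_countP q8.
rewrite natrD; set p := (p_start _ _ _)%:R; move=> pb.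
have rm' : r%:R + 1 <= (p_count q l)%:R :> R by rewrite natr1 ler_nat.
have r0 : 0 <= r%:R :> R by [].
set u := centre a in pb *.
have -> : (p + r%:R) / q%:R - u = (p + r%:R - q%:R * u) / q%:R by field; rewrite gt_eqF.
rewrite normf_div (gtr0_norm q0R) ler_pdivrMr // mulrBl mulVf ?gt_eqF //.
by rewrite ler_norml; lra.
Qed.

Lemma next_stage (M : R) n (N : seq (node R)) l : 1 <= M -> valid N l ->
  exists N' l', valid N' l' /\ refines M n N l N' l'.
Proof.
move=> M1 [l01 w0 w1 hN]; have /andP[l0 l1] := l01.
set s := (n + 5)%N; have s5 : (5 <= s)%N by rewrite leq_addl.
have e0 : 0 < (1 / 2) ^+ n :> R by rewrite exprn_gt0.
have [T1 HT1] := node_estimate s5 l01 M1 e0.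
have [T2 HT2] := @many_primes s (size N) (leq_trans (isT : (0 < 5)%N) s5).
(* [T1] gives the Fourier estimate, [T2] the supply of primes, [n] the growth along the tower, and
   the last term [q * l >= 8] for all primes used. *)
set t := (T1 + T2 + n + (Num.truncn (8 / l)).+1)%N.
have tT1 : (T1 <= t)%N by rewrite /t -!addnA leq_addr.
have tT2 : (T2 <= t)%N by rewrite /t (addnC T1) -!addnA leq_addr.
have tn : (n <= t)%N by rewrite /t -addnA addnCA leq_addr.
have t8 : 8 / l <= t%:R.
  have k0 : 0 <= 8 / l by rewrite divr_ge0 // ltW.
  have /andP[_ kt] := @truncn_itv R _ k0.
  by apply: ltW; apply: (lt_le_trans kt); rewrite ler_nat leq_addl.
have {HT1} := HT1 t tT1; have [P [uP hP sP]] := HT2 t tT2.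
have s1 : s.-1 = (n + 4)%N by rewrite /s addnS.
rewrite s1 in hP sP *.
set W := (2 ^ (t * (n + 4)))%N in hP sP *; set Y := (2 ^ (t * s))%N in hP *.
move=> /= HT1.
have tW : (t <= W)%N.
  apply: leq_trans (ltnW (ltn_expl t (isT : 1 < 2)%N)) _.
  by rewrite leq_exp2l // leq_pmulr // addnS.
have W0 : (0 < W)%N by rewrite expn_gt0.
have Y1 : 1 <= Y%:R :> R by rewrite ler1n expn_gt0.
have [WE YE] : W = (2 ^ (t * (n + 4)))%N /\ Y = (2 ^ (t * s))%N by [].
clearbody W Y t.
set l' := (M * Y%:R ^+ 4)^-1.
have M0 : 0 < M by apply: lt_le_trans M1.
have Y0 : 0 < Y%:R :> R by apply: lt_le_trans Y1.
have l'0 : 0 < l' by rewrite invr_gt0 mulr_gt0 // exprn_gt0.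
have l'Y : l' <= Y%:R^-1.
  rewrite lef_pV2 ?posrE ?mulr_gt0 ?exprn_gt0 // -[X in X <= _]mul1r.
  by apply: ler_pM => //; rewrite -[X in X <= _]expr1 ler_weXn2l.
have hq q : q \in P -> (0 < q)%N && (8 <= q%:R * l).
  move=> /hP /and3P[pq Wq _]; rewrite prime_gt0 //= -ler_pdivrMr //.
  by apply: le_trans t8 _; rewrite ler_nat; apply: leq_trans tW (ltnW Wq).
have m0 q : q \in P -> (0 < p_count q l)%N by move=> /hq /andP[_ /p_countP[]].
have Yq q : q \in P -> l' <= q%:R^-1.
  move=> qP; have /andP[q0 _] := hq q qP; apply: le_trans l'Y _.
  rewrite lef_pV2 ?posrE ?Y0 ?ltr0n // ler_nat.
  by have /and3P[] := hP q qP.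
set K := attach l W N P.
have KN : [seq k.1 | k <- K] = N by exact: attach_parents.
have hK := attachP (l := l) uP sP; rewrite -/K in hK.
have l2 a : a \in N -> l / 2 <= centre a by move=> /hN; lra.
have hK1 k : k \in K -> \sum_(c <- k.2) c.1 = 1.
  move=> /hK[kN [Q [uQ sQ QP] ->]]; apply: sum_kids_weight; first by rewrite sQ.
  by move=> q /QP /m0.
have hK0 k : k \in K -> {in k.2, forall c, 0 <= c.1}.
  move=> /hK[kN [Q [uQ sQ QP] ->]] c /mem_kids[q [r [_ _ ->]]] /=.
  by rewrite invr_ge0 mulr_ge0.
have inside k c : k \in K -> c \in k.2 -> `|centre c - centre k.1| <= (l - l') / 2.
  move=> /hK[kN [Q [uQ sQ QP] ->]] ck.
  have qP : c.2.2 \in P by case/mem_kids: ck => q [r [qQ _ ->]]; exact: QP.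
  apply: le_trans (kid_inside l0 (l2 _ kN) _ ck) _; first by move=> q /QP /hq.
  by have := Yq _ qP; lra.
have kw0 k : k \in K -> 0 <= k.1.1 by move=> /hK[/w0].
have big_refine (f : nat * nat -> R) :
    \sum_(c <- refine K) c.1 * f c.2 = \sum_(k <- K) k.1.1 * \sum_(c <- k.2) c.1 * f c.2.
  rewrite big_flatten big_map; apply: eq_bigr => k _; rewrite big_map mulr_sumr.
  by apply: eq_bigr => c _; rewrite mulrA.
have sumK : \sum_(k <- K) k.1.1 = 1 by rewrite -w1 -[in RHS]KN big_map.
have kid_spec c : c \in refine K -> exists2 k, k \in K & exists2 d, d \in k.2 &
    c = (k.1.1 * d.1, d.2) by exact: mem_refine.
have qP c : c \in refine K -> c.2.2 \in P.
  case/kid_spec => k kK [d dk ->] /=; exact: attach_mem_prime kK _ dk.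
have pos c : c \in refine K -> 1 / 4 + l' / 2 <= centre c <= 3 / 4 - l' / 2.
  case/kid_spec => k kK [d dk ->]; have := inside k d kK dk.
  have /hN : k.1 \in N by case/hK: kK.
  by rewrite [centre (_, _)]/centre /= -/(centre d) ler_norml; lra.
exists (refine K), l'; split; split.
- rewrite l'0 (le_trans l'Y) // invf_le1 //.
- by move=> c /kid_spec[k kK [d dk ->]] /=; rewrite mulr_ge0 ?kw0 //; exact: hK0 dk.
- under eq_bigr do rewrite -[_.1]mulr1.
  rewrite (big_refine (fun=> 1)) -[RHS]sumK big_seq [RHS]big_seq; apply: eq_bigr => k kK.
  rewrite -[RHS]mulr1; congr (_ * _); rewrite -[RHS](hK1 k kK).
  by apply: eq_bigr => c _; exact: mulr1.
- exact: pos.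
- move=> x x01; rewrite -[in X in _ - X]KN -parents_pointsK -children_pointsK.
  have [|||_ /mapP[k kK ->] [-> [_ /= /mapP[c ck ->] ->]]] := @step_children R 0 (pointsK K) x.
  + move=> _ /mapP[k kK ->] /=; split; first exact: kw0.
    by move=> _ /mapP[c ck ->] /=; exact: hK0 ck.
  + by move=> _ /mapP[k kK ->] /=; rewrite big_map /=; exact: hK1.
  + by rewrite big_map /= sumK add0r.
  exact: inside.
(* The two layers are compared parent by parent; the weights sum to [1], so the bound for one node
   carries over to the layer. *)
- move=> eta th eta0; rewrite /layer_cos.
  rewrite (big_refine (fun pq => cos (2 * pi * eta * (pq.1%:R / pq.2%:R) + th))).
  rewrite -[in X in _ - X]KN big_map !mulr_sumr -sumrB.
  apply: le_trans (ler_norm_sum _ _ _) _.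
  apply: le_trans (_ : \sum_(k <- K) k.1.1 * ((1 / 2) ^+ n * (1 + eta) `^ rate R s) <= _); last first.
    by rewrite -mulr_suml sumK mul1r.
  rewrite big_seq [X in _ <= X]big_seq; apply: ler_sum => k kK.
  rewrite mulrCA [X in _ - X]mulrCA -mulrBr normrM (ger0_norm (kw0 _ kK)).
  apply: ler_wpM2l; first exact: kw0.
  have [kN [Q [uQ sQ QP] E]] := hK k kK.
  rewrite E sum_kids_cos; apply: HT1 => //; first exact: l2.
  by move=> q /QP /hP.
- exists t => //; rewrite -/s -YE -WE; split => //.
  + move=> c cK; have /hP/and3P[-> -> ->] := qP c cK; split=> //.
    have := pos c cK; rewrite /centre; have /hq/andP[q0 _] := qP c cK.
    have q0R : 0 < c.2.2%:R :> R by rewrite ltr0n.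
    move=> /andP[h1 h2]; apply/andP; split.
      rewrite lt0n; apply/eqP => E; rewrite E mul0r in h1; lra.
    rewrite -(ltr_nat R) -[X in _ < X]mul1r -ltr_pdivrMr //; lra.
  (* Equal denominators mean a common parent, and both centres are within [(l - l') / 2] of the
     parent's. *)
  + move=> c d /kid_spec[k kK [c' ck ->]] /kid_spec[k' kK' [d' dk ->]] /= E.
    have kk : k = k' by exact: (attach_inj uP kK kK' ck dk E).
    rewrite -kk in dk; have := inside k c' kK ck; have := inside k d' kK dk.
    rewrite [centre (_, c'.2)]/centre [centre (_, d'.2)]/centre /= -/(centre c') -/(centre d').
    by rewrite !ler_norml; lra.
Qed.

Lemma root_valid : valid [:: (1, (1%N, 2%N))] (1 / 2 : R).
Proof.
split.
- by apply/andP; split; lra.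
- by move=> a; rewrite inE => /eqP ->.
- by rewrite big_seq1.
- by move=> a; rewrite inE => /eqP ->; rewrite /centre /=; apply/andP; split; lra.
Qed.

End next.

(** * Fourier decay *)

Section tower.
Variable R : realType.

Definition tower (M : R) (N : nat -> seq (node R)) (l : nat -> R) :=
  forall n, valid (N n) (l n) /\ refines M n (N n) (l n) (N n.+1) (l n.+1).

Lemma tower_exists (M : R) : 1 <= M -> exists N l, tower M N l.
Proof.
move=> M1; pose X := (nat * (seq (node R) * R))%type.
(* The guard makes [rel] total, as dependent choice demands; the stage number is part of the state
   because [refines] depends on it. *)
pose rel (x y : X) := valid x.2.1 x.2.2 ->
  [/\ y.1 = x.1.+1, valid y.2.1 y.2.2 & refines M x.1 x.2.1 x.2.2 y.2.1 y.2.2].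
have ex x : {y | rel x y}.
  apply: cid; have [v|nv] := pselect (valid x.2.1 x.2.2); last by exists x.
  have [N' [l' [v' r']]] := next_stage x.1 M1 v.
  by exists (x.1.+1, (N', l')).
have [f [f0 fS]] := dependent_choice ex (0%N, ([:: (1, (1%N, 2%N))], 1 / 2)).
have fv n : (f n).1 = n /\ valid (f n).2.1 (f n).2.2.
  elim: n => [|n [En vn]]; first by rewrite f0; split => //; exact: root_valid.
  by have [-> v' _] := fS n vn; rewrite En.
exists (fun n => (f n).2.1), (fun n => (f n).2.2) => n.
have [En vn] := fv n; split=> //.
by have [_ _] := fS n vn; rewrite En.
Qed.

Lemma le_of_le_add_inv (x y c : R) : (forall k, x <= y + c / k.+1%:R) -> x <= y.
Proof.
move=> H; rewrite leNgt; apply/negP => yx.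
have d0 : 0 < x - y by rewrite subr_gt0.
have c0 : 0 < c.
  rewrite ltNge; apply/negP => c0; have := H 0%N; rewrite divr1; lra.
have k0 : 0 <= c / (x - y) by rewrite divr_ge0 ?ltW.
have /andP[_ kt] := @truncn_itv R _ k0.
have := H (Num.truncn (c / (x - y))).
rewrite ltr_pdivrMr // in kt.
set k := _.+1%:R in kt *; have k1 : 0 < k :> R by rewrite ltr0n.
by rewrite -lerBlDl ler_pdivlMr //; lra.
Qed.

Section decay.
Variables (M : R) (N : nat -> seq (node R)) (l : nat -> R).
Hypothesis M1 : 1 <= M.
Hypothesis tow : tower M N l.

Lemma tower_length_le n : l n.+1 <= n.+1%:R^-1.
Proof.
have [_ [_ _ [t nt [-> _ _]]]] := tow n.
have Y1 : n.+1%:R <= (2 ^ (t * (n + 5)))%:R :> R.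
  rewrite ler_nat; apply: leq_trans (_ : 2 ^ t <= _)%N.
    by apply: leq_trans (ltn_expl t (isT : 1 < 2)%N); rewrite ltnS.
  by rewrite leq_exp2l // leq_pmulr // addnS.
move: (2 ^ _)%:R Y1 => Y Y1.
have n1 : 1 <= n.+1%:R :> R by rewrite ler1n.
have Y0 : 1 <= Y by apply: le_trans Y1.
have M0 : 0 < M by apply: lt_le_trans M1.
have Yp : 0 < Y by apply: lt_le_trans Y0.
rewrite lef_pV2 ?posrE ?ltr0n ?mulr_gt0 ?exprn_gt0 //.
apply: le_trans Y1 _; rewrite -[X in X <= _]mul1r; apply: ler_pM => //; first exact: ltW.
by rewrite -[X in X <= _]expr1 ler_weXn2l.
Qed.

Let w0 n : {in points (N n), forall a, 0 <= a.1}.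
Proof. by move=> _ /mapP[a aN ->]; have [[_ h _ _] _] := tow n; exact: h. Qed.

Let w1 n : \sum_(a <- points (N n)) a.1 = 1.
Proof. by rewrite big_map; have [[_ _ h _] _] := tow n. Qed.

Let l01 n : 0 < l n <= 1. Proof. by have [[]] := tow n. Qed.

Let l0 n : 0 <= l n. Proof. by case/andP: (l01 n) => /ltW. Qed.

Definition tower_set := cover (fun n => points (N n)) l.

Lemma sum_cos_le1 n eta th :
  `|\sum_(a <- N n) a.1 * cos (2 * pi * eta * centre a + th)| <= 1.
Proof.
apply: le_trans (ler_norm_sum _ _ _) _.
rewrite -(w1 n) big_map big_seq [X in _ <= X]big_seq; apply: ler_sum => a aN.
rewrite normrM ger0_norm; last by have [[_ h _ _] _] := tow n; exact: h.
by rewrite ler_piMr ?cos_max //; have [[_ h _ _] _] := tow n; exact: h.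
Qed.

Lemma layer_cos_first n b eta th : 0 < eta -> 0 <= b <= 1 ->
  `|layer_cos (N n) (l n) eta th| <= 2 / l n * (1 + eta) `^ (- b).
Proof.
move=> e0 /andP[b0 b1]; have /andP[lp l1] := l01 n.
have x1 : 1 <= 1 + eta by rewrite lerDl ltW.
have x0 : 0 < 1 + eta by apply: lt_le_trans x1.
apply: le_trans (_ : 2 / l n * (1 + eta)^-1 <= _); last first.
  apply: ler_wpM2l; first by rewrite divr_ge0.
  by rewrite -powR_inv1 ?(ltW x0) // ler_powR // lerN2.
rewrite normrM; apply: le_trans (_ : `|sinc (pi * eta * l n)| * 1 <= _).
  by rewrite ler_wpM2l // sum_cos_le1.
rewrite mulr1 (_ : 2 / l n * (1 + eta)^-1 = 2 / (l n * (1 + eta))); last by rewrite invfM mulrA.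
have [e1|e1] := lerP 1 eta.
  apply: le_trans (sinc_le_inv _) _; first by rewrite !mulr_gt0 // pi_gt0.
  rewrite -[X in X <= _]mul1r ler_pdivrMr; last by rewrite !mulr_gt0 // pi_gt0.
  rewrite mulrAC ler_pdivlMr ?mulr_gt0 // mul1r.
  have p2 := pi_ge2 R.
  have h : 1 + eta <= pi * eta by nra.
  have -> : 2 * (pi * eta * l n) = l n * (2 * (pi * eta)) by ring.
  by rewrite ler_pM2l //; lra.
apply: le_trans (sinc_le1 _) _; rewrite ler_pdivlMr ?mulr_gt0 // mul1r.
by have : l n * (1 + eta) <= 1 * (1 + eta); [rewrite ler_pM2r | lra].
Qed.

(** Telescoping from layer [n], with [2 - 2 * (1/2)^k] the sum of the first [k] powers of [1/2]. The
    early layers, whose rate may be worse than [- b], enter only through the constant [2 / l n]. *)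
Lemma layer_cos_le n b k eta th : 0 < eta -> 0 <= b <= 1 ->
  (forall m, (n <= m)%N -> rate R (m + 5) <= - b) ->
  `|layer_cos (N (n + k)) (l (n + k)) eta th| <=
     (2 / l n + (2 - 2 * (1 / 2) ^+ k)) * (1 + eta) `^ (- b).
Proof.
move=> e0 b01 hr; elim: k => [|k IH].
  by rewrite addn0 expr0 mulr1 subrr addr0; exact: layer_cos_first.
have [_ [_ hF _]] := tow (n + k)%N; have H := hF eta th e0; rewrite addnS.
set A := layer_cos _ _ _ _ in H *; set B := layer_cos _ _ _ _ in H IH.
have -> : A = (A - B) + B by ring.
apply: le_trans (ler_normD _ _) _.
have x1 : 1 <= 1 + eta by rewrite lerDl ltW.
have : (1 / 2) ^+ (n + k) * (1 + eta) `^ rate R (n + k + 5) <= (1 / 2) ^+ k * (1 + eta) `^ (- b).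
  apply: ler_pM; rewrite ?exprn_ge0 ?powR_ge0 //.
    by rewrite ler_wiXn2l ?leq_addl //; lra.
  by rewrite ler_powR // hr // leq_addr.
rewrite exprS; move: (_ `^ (- b)) IH => tau IH H'.
have -> : (2 / l n + (2 - 2 * (1 / 2 * (1 / 2) ^+ k))) * tau =
    (1 / 2) ^+ k * tau + (2 / l n + (2 - 2 * (1 / 2) ^+ k)) * tau.
  by have /andP[lp _] := l01 n; move: ((1 / 2) ^+ k) => y; field; rewrite gt_eqF.
by apply: lerD => //; apply: le_trans H H'.
Qed.

(** One measure serves all [b < 1/4]; only the starting layer [n], hence [C], depends on [b]. *)
Lemma tower_decay_cos : exists mu : probability (measurableTypeR R) R,
  mu tower_set = 1%E /\
  forall b, 0 <= b < 1 / 4 -> exists2 C, 0 < C & forall eta th, 0 < eta ->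
    `|\int[mu]_(x in setT) cos (2 * pi * eta * x + th)| <= C * (1 + eta) `^ (- b).
Proof.
have nest n x : 0 <= x < 1 -> `|step 0 (points (N n.+1)) x - step 0 (points (N n)) x| <=
    (l n - l n.+1) / 2 by have [_ [h _ _]] := tow n; exact: h.
have [mu [muE hmu]] := limit_measure w0 w1 nest l0.
exists mu; split=> // b /andP[b0 b4].
have d0 : 0 < 1 / 4 - b by rewrite subr_gt0.
set n := Num.truncn (1 / 4 - b)^-1.
have hr m : (n <= m)%N -> rate R (m + 5) <= - b.
  move=> nm; rewrite /rate; suff : (m + 5)%:R^-1 <= 1 / 4 - b by lra.
  rewrite invf_ple ?posrE ?ltr0n ?addnS // -addnS.
  have i0 : 0 <= (1 / 4 - b)^-1 by rewrite invr_ge0 ltW.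
  have /andP[_ kt] := @truncn_itv R _ i0.
  by apply: ltW; apply: (lt_le_trans kt); rewrite ler_nat -/n; lia.
have /andP[lp _] := l01 n.
have C0 : 0 < 2 / l n + 2 by rewrite addr_gt0 // divr_gt0.
exists (2 / l n + 2) => // eta th e0.
(* With [eta] fixed, [k] tends to infinity. Passing from [mu] to the discrete sum, and from that sum
   to the layer, each costs at most [pi * eta * l m <= 4 * eta / k.+1]. *)
apply: (@le_of_le_add_inv _ _ (8 * eta + 8 * eta)) => k.
set m := (n + k.+1)%N.
have lk : l m <= k.+1%:R^-1.
  rewrite /m addnS; apply: le_trans (tower_length_le _) _.
  by rewrite lef_pV2 ?posrE ?ltr0n // ler_nat ltnS leq_addl.
have p4 : pi <= 4 :> R by have := pihalf_lt2 R; lra.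
have p0 := pi_gt0 R.
have /andP[lmp _] := l01 m.
have pe : pi * eta * l m <= 4 * eta / k.+1%:R.
  by apply: ler_pM => //; rewrite ?mulr_ge0 ?(ltW p0) ?(ltW e0) // ler_pM2r.
have := hmu m (2 * pi * eta) th; rewrite big_map /=.
set I := \int[mu]_(x in _) _; set S := \sum_(a <- N m) _.
have -> : `|2 * pi * eta| * (l m / 2) = pi * eta * l m.
  by rewrite gtr0_norm ?mulr_gt0 //; field.
move=> H1.
have b1 : 0 <= b <= 1 by rewrite b0; lra.
have H2 := @layer_cos_le n b k.+1 eta th e0 b1 hr; rewrite -/m in H2.
have H3 : `|S - layer_cos (N m) (l m) eta th| <= pi * eta * l m.
  have -> : S - layer_cos (N m) (l m) eta th = - ((sinc (pi * eta * l m) - 1) * S).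
    by rewrite /layer_cos -/S; ring.
  rewrite normrN normrM; apply: le_trans (_ : `|sinc (pi * eta * l m) - 1| * 1 <= _).
    by rewrite ler_wpM2l // sum_cos_le1.
  by rewrite mulr1 sinc_sub1 // !mulr_gt0.
have -> : I = (I - S) + ((S - layer_cos (N m) (l m) eta th) + layer_cos (N m) (l m) eta th) by ring.
apply: le_trans (ler_normD _ _) _.
have := ler_normD (S - layer_cos (N m) (l m) eta th) (layer_cos (N m) (l m) eta th).
have tau0 : 0 <= (1 + eta) `^ (- b) by exact: powR_ge0.
have /(le_trans H2) : (2 / l n + (2 - 2 * (1 / 2) ^+ k.+1)) * (1 + eta) `^ (- b) <= (2 / l n + 2) * (1 + eta) `^ (- b).
  rewrite ler_wpM2r // lerD2l lerBlDr lerDl mulr_ge0 // exprn_ge0 //; lra.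
have -> : (8 * eta + 8 * eta) / k.+1%:R = 4 * (4 * eta / k.+1%:R) by ring.
have : 0 <= 4 * eta / k.+1%:R by rewrite divr_ge0 // mulr_ge0 // ltW.
move: (4 * eta / _) ((2 / l n + 2) * _) (pi * eta * l m) pe H1 H3 => x y z; lra.
Qed.

Lemma normc_le (x y : R) : ComplexField.Normc.normc (x +i* y)%C <= `|x| + `|y|.
Proof.
rewrite /ComplexField.Normc.normc -(@ger0_norm _ (`|x| + `|y|)) ?addr_ge0 // -sqrtr_sqr.
apply: ler_wsqrtr; rewrite sqrrD !real_normK ?num_real // -addrA lerD2l lerDr.
by rewrite mulrn_wge0 // mulr_ge0.
Qed.

Lemma tower_fourier_decay beta : 0 <= beta < 1 / 2 -> fourier_decay tower_set beta.
Proof.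
move=> /andP[b0 b2]; have [mu [muE hmu]] := tower_decay_cos.
exists mu; split=> //.
have [|C C0 hC] := hmu (beta / 2); first by apply/andP; split; lra.
exists (2 * C + 2); split; first by lra.
move=> xi; rewrite /fourier_transform /cintegral /=.
apply: le_trans (normc_le _ _) _.
(* The decay is known for positive frequencies only; at [0] the summand [2] of the constant
   suffices. *)
have [->|xi0] := eqVneq xi 0.
  rewrite normr0 addr0 powR1 mulr1.
  have c1 f : measurable_fun setT (f : measurableTypeR R -> R) -> (forall x, `|f x| <= 1) ->
    `|\int[mu]_(x in setT) f x| <= 1 by move=> mf; exact: Rintegral_le_bound.
  under [X in `|X| + _]eq_Rintegral do rewrite mulr0 oppr0 cos0.
  under [X in _ + `|X|]eq_Rintegral do rewrite mulr0 oppr0 sin0.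
  have := c1 (fun=> 1) (@measurable_cst _ _ _ _ _ _) (fun x => _).
  have := c1 (fun=> 0) (@measurable_cst _ _ _ _ _ _) (fun x => _).
  rewrite normr0 normr1 => /(_ (fun=> ler01)) h1 /(_ (fun=> lexx _)) h2; lra.
set eta := `|xi|; have eta0 : 0 < eta by rewrite normr_gt0.
have hcos : \int[mu]_(x in setT) cos (- (2 * pi * x * xi)) =
    \int[mu]_(x in setT) cos (2 * pi * eta * x + 0).
  apply: eq_Rintegral => x _; rewrite cosN addr0 -(cos_norm (2 * pi * eta * x)) -cos_norm.
  by rewrite !normrM normr_id; congr cos; ring.
have [th hsin] : exists th, \int[mu]_(x in setT) sin (- (2 * pi * x * xi)) =
    \int[mu]_(x in setT) cos (2 * pi * eta * x + th).
  have [x0|x0] := lerP 0 xi.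
    exists (pi / 2); apply: eq_Rintegral => x _.
    by rewrite cosDpihalf sinN /eta ger0_norm //; congr (- sin _); ring.
  exists (- (pi / 2)); apply: eq_Rintegral => x _.
  by rewrite cosBpihalf /eta ltr0_norm //; congr (sin _); ring.
rewrite hcos hsin; have := hC eta 0 eta0; have := hC eta th eta0.
have := powR_ge0 (1 + eta) (- (beta / 2)).
move: (_ `^ _) => tau t0 h1 h2; nra.
Qed.

End decay.
End tower.

(** * Absence of nontrivial solutions *)

(* Modulo [q k], only the terms with the same denominator as [k] survive in
   the numerator of the sum. *)
Lemma sum_fractions_eq0 (R : realType) (I : finType) (e : I -> int) (p q : I -> nat) (Y : nat) :
  (forall i, [/\ prime (q i), q i <= Y & 0 < p i < q i])%N ->
  (forall i j, q i = q j -> p i = p j) ->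
  `|\sum_i (e i)%:~R * ((p i)%:R / (q i)%:R)| * Y%:R ^+ #|I| < 1 :> R ->
  (forall i, \sum_j `|e j|%N < q i)%N ->
  forall k, \sum_(i | q i == q k) e i = 0.
Proof.
move=> hpq hp small eq k.
pose u := undup [seq q i | i <- enum I].
pose G r := (\prod_(s <- u | s != r) s)%N; pose D := (\prod_(s <- u) s)%N.
have qu i : q i \in u by rewrite mem_undup map_f // mem_enum.
have uprime s : s \in u -> prime s.
  by rewrite mem_undup => /mapP[i _ ->]; have [] := hpq i.
have DG i : D = (q i * G (q i))%N.
  by rewrite /D /G (bigD1_seq (q i)) //= undup_uniq.
have DY : (D <= Y ^ #|I|)%N.
  apply: leq_trans (_ : Y ^ size u <= _)%N.
    rewrite -iter_muln_1 -(count_predT u) -big_const_seq /D big_seq [X in (_ <= X)%N]big_seq.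
    apply: leq_prod => s; rewrite mem_undup => /mapP[i _ ->]; by have [] := hpq i.
  have [pk qY _] := hpq k.
  rewrite leq_pexp2l //; first exact: leq_trans (prime_gt0 pk) qY.
  by rewrite (leq_trans (size_undup _)) // size_map -cardE.
(* [T] is the numerator of the sum over the common denominator [D <= Y ^ #|I|]; it is an integer of
   absolute value below [1]. *)
pose T := \sum_i e i * ((p i)%:Z * (G (q i))%:Z).
have TE : T%:~R = D%:R * \sum_i (e i)%:~R * ((p i)%:R / (q i)%:R) :> R.
  rewrite /T rmorph_sum mulr_sumr; apply: eq_bigr => i _.
  have [pq _ _] := hpq i; have q0 : (q i)%:R != 0 :> R by rewrite pnatr_eq0 -lt0n prime_gt0.
  by rewrite !rmorphM /= (DG i) natrM; field.
have T0 : T = 0.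
  apply/eqP; rewrite -absz_eq0 -leqn0 leqNgt; apply/negP => T0.
  suff : `|T%:~R| < 1 :> R by rewrite -intr_norm -[X in _ < X]/(1%:~R) ltr_int; lia.
  rewrite TE normrM mulrC; apply: le_lt_trans small; apply: ler_wpM2l => //.
  by rewrite ger0_norm // -natrX ler_nat.
have [pk _ /andP[p0 pq]] := hpq k.
have : (q k %| (\sum_(i | q i == q k) e i) * ((p k)%:Z * (G (q k))%:Z))%Z.
  have -> : (\sum_(i | q i == q k) e i) * ((p k)%:Z * (G (q k))%:Z) =
      T - \sum_(i | q i != q k) e i * ((p i)%:Z * (G (q i))%:Z).
    rewrite /T [X in _ = X - _](bigID (fun i => q i == q k)) /= addrK mulr_suml.
    by apply: eq_bigr => i /eqP E; rewrite E (hp _ _ E).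
  rewrite T0 sub0r rpredN; apply: rpred_sum => i ik.
  rewrite dvdz_mull // dvdz_mull // dvdzE /= /G.
  by rewrite eq_sym in ik; rewrite big_mkcond (bigD1_seq (q k)) //= ?undup_uniq // ik dvdn_mulr.
(* The prime [q k] divides neither [p k], which is smaller, nor [G (q k)], a product of other
   primes. It therefore divides the coefficient sum, whose absolute value is below [q k]. *)
rewrite dvdzE /= abszM abszM /= !Euclid_dvdM //.
have -> : (q k %| p k)%N = false by apply/negbTE; rewrite gtnNdvd.
have -> : (q k %| G (q k))%N = false.
  apply/negbTE; rewrite /G Euclid_dvd_prod // big_has_cond; apply/hasPn => s /= /uprime sp.
  by apply/negP => /andP[sk]; rewrite dvdn_prime2 // eq_sym (negbTE sk).
rewrite !orbF; set S := \sum_(i | _) _ => qS; apply/eqP; rewrite -absz_eq0.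
apply/eqP; move: qS; have [->//|S0] := posnP `|S|%N.
move=> /dvdn_leq -/(_ S0); rewrite leqNgt => /negP[].
apply: leq_ltn_trans (eq k); rewrite -lez_nat abszE.
apply: le_trans (ler_norm_sum _ _ _) _; rewrite -natz natr_sum.
rewrite big_mkcond; apply: ler_sum => i _; case: ifP => _ //; rewrite ?natz ?abszE //.
Qed.

(** * Linear relations between points of the limit set *)

Section independence.
Variables (R : realType) (M : R) (N : nat -> seq (node R)) (l : nat -> R).
Hypothesis M1 : 1 <= M.
Hypothesis tow : tower M N l.

Lemma tower_independent (e : 'I_4 -> int) (x : 'I_4 -> R) :
  (\sum_j `|e j|%N)%:R <= M -> (forall i, tower_set N l (x i)) ->
  \sum_i (e i)%:~R * x i = 0 -> forall k, \sum_(i | x i == x k) e i = 0.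
Proof.
set K := (\sum_j _)%N => KM xE ex0.
(* Large enough that the denominators exceed [K] and that distinct points are more than [2 * l n]
   apart. For equal points the term is [2 / 0 = 0]. *)
set n' := (K + \sum_i \sum_j (Num.truncn (2 / `|x i - x j|)%R).+1)%N; set n := n'.+1.
have [[l01 _ _ _] [hnest _ [t nt [l'E hN hq]]]] := tow n.
have /andP[l0 _] := l01.
have ll' : l n.+1 <= l n.
  have := hnest 0; rewrite lexx ltr01 => /(_ isT) /(le_trans (normr_ge0 _)).
  by rewrite pmulr_lge0 ?subr_ge0 // invr_gt0.
have far i j : x i != x j -> 2 * l n < `|x i - x j|.
  rewrite -subr_eq0 -normr_gt0 => d0.
  have k0 : 0 <= 2 / `|x i - x j| by rewrite divr_ge0.
  have /andP[_ kt] := @truncn_itv R _ k0.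
  have tn : (2 / `|x i - x j|) < n%:R.
    apply: lt_le_trans kt _; rewrite ler_nat /n /n' (bigD1 i) //= (bigD1 j) //=; lia.
  have := tower_length_le M1 tow n'; rewrite -/n => ln.
  have n0 : 0 < n%:R :> R by rewrite ltr0n.
  rewrite ltr_pdivrMr // mulrC -ltr_pdivrMr // in tn.
  by apply: le_lt_trans tn; rewrite ler_pM2l.
(* Nodes are chosen by value, not by index, so equal points get the same fraction. *)
have [f hf] : exists f : R -> node R, forall y, tower_set N l y ->
    f y \in N n.+1 /\ `|y - centre (f y)| <= l n.+1 / 2.
  suff [f hf] : {f : R -> node R & forall y, tower_set N l y ->
    f y \in N n.+1 /\ `|y - centre (f y)| <= l n.+1 / 2} by exists f.
  apply: (choice (P := fun y c => tower_set N l y ->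
     c \in N n.+1 /\ `|y - centre c| <= l n.+1 / 2)) => y.
  have [yE|nyE] := pselect (tower_set N l y); last by exists (0, (0%N, 0%N)) => /nyE.
  by have [_ /mapP[c cN ->] h] := yE n.+1; exists c.
pose q i := (f (x i)).2.2; pose p i := (f (x i)).2.1.
(* Equal denominators put the centres within [l n], hence the points within
   [l n + l n.+1 <= 2 * l n], against [far]. *)
have qx i j : q i = q j -> x i = x j.
  move=> E; apply/eqP; apply/negPn/negP => /far; apply/negP; rewrite -leNgt.
  have [iN di] := hf _ (xE i); have [jN dj] := hf _ (xE j).
  have := hq _ _ iN jN E; move: di dj; rewrite !ler_norml; lra.
set Y := (2 ^ (t * (n + 5)))%N in l'E hN.
have Y0 : 0 < Y%:R :> R by rewrite ltr0n expn_gt0.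
have M0 : 0 < M by apply: lt_le_trans M1.
have l'0 : 0 <= l n.+1 by rewrite l'E invr_ge0 mulr_ge0 ?exprn_ge0 // ltW.
(* The relation holds exactly for the [x i], so the fractions satisfy it up to [K * l n.+1 / 2].
   Multiplied by [Y^4], one [Y] per variable, this is [K / M / 2 < 1]. *)
have small : `|\sum_i (e i)%:~R * ((p i)%:R / (q i)%:R)| * Y%:R ^+ #|'I_4| < 1 :> R.
  have -> : \sum_i (e i)%:~R * ((p i)%:R / (q i)%:R) =
     \sum_i (e i)%:~R * (centre (f (x i)) - x i) :> R.
    by under [RHS]eq_bigr do rewrite mulrBr; rewrite sumrB ex0 subr0.
  rewrite card_ord; apply: le_lt_trans (_ : (K%:R * (l n.+1 / 2)) * Y%:R ^+ 4 < 1).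
    rewrite ler_pM2r ?exprn_gt0 //; apply: le_trans (ler_norm_sum _ _ _) _.
    rewrite /K natr_sum mulr_suml; apply: ler_sum => i _.
    rewrite normrM distrC natr_absz intr_norm; apply: ler_pM => //.
    by have [] := hf _ (xE i).
  rewrite l'E invfM.
  have -> : K%:R * (M^-1 * (Y%:R ^+ 4)^-1 / 2) * Y%:R ^+ 4 = K%:R / M / 2 :> R.
    by field; rewrite !gt_eqF.
  have : K%:R / M <= 1 by rewrite ler_pdivrMr // mul1r.
  lra.
move=> k; rewrite -[RHS](sum_fractions_eq0 (q := q) (p := p) _ _ small _ k).
- apply: eq_bigl => i; apply/eqP/eqP => [E|/qx //]; by rewrite /q E.
- by move=> i; have [/hN[-> /andP[_ ->] ->] _] := hf _ (xE i).
- by move=> i j /qx E; rewrite /p E.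
move=> i; have [/hN[_ /andP[Wq _] _] _] := hf _ (xE i).
apply: leq_trans Wq; rewrite ltnS -/K; apply: leq_trans (_ : n <= _)%N; first by rewrite /n /n' leqW // leq_addr.
apply: leq_trans nt _; apply: leq_trans (ltnW (ltn_expl t (isT : 1 < 2)%N)) _.
by rewrite leq_exp2l // leq_pmulr // addnS.
Qed.

(** On each class of equal variables the coefficients sum to [0]. In genus one the class of [x1]
    must be everything. In genus two the zero subsum gives [{a, b} = {c, d}], and positivity leaves
    only the trivial matchings of the two sides. *)
Lemma tower_no_solution (a b c d : nat) (x1 x2 y1 y2 : R) :
  (0 < a)%N -> (0 < b)%N -> (0 < c)%N -> (0 < d)%N -> (a + b = c + d)%N ->
  (a + b + c + d)%:R <= M ->
  tower_set N l x1 -> tower_set N l x2 -> tower_set N l y1 -> tower_set N l y2 ->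
  a%:R * x1 + b%:R * x2 = c%:R * y1 + d%:R * y2 ->
  trivial_solution a b c d x1 x2 y1 y2.
Proof.
move=> a0 b0 c0 d0 abcd hM hx1 hx2 hy1 hy2 eqn.
pose e := tnth (eqn_coef a b c d); pose x := tnth [tuple x1; x2; y1; y2].
have H k : \sum_(i | x i == x k) e i = 0.
  apply: tower_independent.
  - by rewrite !big_ord_recl big_ord0 /e /= !(tnth_nth 0) /= !abszN /= addn0 !addnA.
  - case=> [[|[|[|[|//]]]] i4]; rewrite /x (tnth_nth 0) //=.
  - rewrite !big_ord_recl big_ord0 /e /x /= !(tnth_nth 0) /= !rmorphN /=.
    by rewrite addr0 !mulNr -opprD addrA; apply/eqP; rewrite subr_eq0; exact/eqP.
have expand (s : pred 'I_4) : \sum_(i | s i) e i =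
   (if s (inord 0) then a%:Z else 0) + (if s (inord 1) then b%:Z else 0) +
   (if s (inord 2) then - c%:Z else 0) + (if s (inord 3) then - d%:Z else 0).
  rewrite big_mkcond !big_ord_recl big_ord0 /=. rewrite addr0 !addrA.
  have E j (j4 : (j < 4)%N) (i : 'I_4) : i = j :> nat -> i = inord j.
    by move=> ij; apply: val_inj; rewrite /= inordK.
  rewrite -(E 0%N isT ord0) // -(E 1%N isT (lift ord0 ord0)) //.
  rewrite -(E 2 isT (lift ord0 (lift ord0 ord0))) //.
  rewrite -(E 3 isT (lift ord0 (lift ord0 (lift ord0 ord0)))) //.
have xE j : (j < 4)%N -> x (inord j) = nth 0 [:: x1; x2; y1; y2] j.
  by move=> j4; rewrite /x (tnth_nth 0) /= inordK.
have H1 := H (inord 0); have H2 := H (inord 1).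
rewrite expand !xE //= eqxx in H1; rewrite expand !xE //= eqxx in H2.
rewrite /trivial_solution; case: ifP => [/forallP g1|/negbT].
  have := g1 [set i | x i == x (inord 0)]%SET; rewrite -(negbK (_ == 0)).
  have -> : \sum_(i in [set i | x i == x (inord 0)]%SET) tnth (eqn_coef a b c d) i = 0.
    by rewrite -[RHS](H (inord 0)); apply: eq_bigl => i; rewrite inE.
  rewrite eqxx /= implybF negb_and !negbK => /orP[/eqP E|/eqP E].
    by have := finset.in_set0 (inord 0 : 'I_4); rewrite -E inE eqxx.
  have all j : (j < 4)%N -> nth 0 [:: x1; x2; y1; y2] j = x1.
    move=> j4; have := finset.in_setT (inord j : 'I_4); rewrite -E inE => /eqP.
    by rewrite !xE.
  by have := all 1%N isT; have := all 2 isT; have := all 3 isT => /= -> -> ->.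
rewrite negb_forall => /existsP[S]; rewrite negb_imply negbK => /andP[/andP[S0 S1] /eqP].
rewrite (expand (mem S)) /= => sS.
(* Membership in [S] is encoded by four booleans, so that finitely many cases of linear arithmetic
   remain. *)
have {S0 S1} : exists i j : bool, exists k m : bool,
  (i || j || k || m) && ~~ (i && j && k && m) /\
  (if i then a%:Z else 0) + (if j then b%:Z else 0) + (if k then - c%:Z else 0) +
    (if m then - d%:Z else 0) = 0.
  exists (inord 0 \in S), (inord 1 \in S), (inord 2 \in S), (inord 3 \in S); split=> //.
  have inordE (i : 'I_4) : [|| i == inord 0, i == inord 1, i == inord 2 | i == inord 3].
    by rewrite -!val_eqE /= !inordK //; case: i => [[|[|[|[|]]]]].
  apply/andP; split.
    apply: contraNT S0 => h; apply/eqP/finset.setP => i; rewrite finset.in_set0.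
    case/or4P: (inordE i) => /eqP ->; by move: h; do 4 case: (_ \in S).
  apply: contraNN S1 => h; apply/eqP/finset.setP => i; rewrite finset.in_setT.
  case/or4P: (inordE i) => /eqP ->; by move: h; do 4 case: (_ \in S).
move=> [i [j [k [m [h sum]]]]].
have genus2 : (a = c /\ b = d) \/ (a = d /\ b = c).
  by move: h sum; case: i; case: j; case: k; case: m => //= _; lia.
move: H1 H2; rewrite (eq_sym x1 x2).
have [E12|n12] := eqVneq x2 x1.
  case: (eqVneq y1 x1) => [E1|_]; last by case: (y2 == x1) => /=; lia.
  case: (eqVneq y2 x1) => [E2 _ _|_] /=; last by lia.
  by rewrite E12 E1 E2; case: genus2 => [[-> ->]|[-> ->]]; [left|right].
case: (eqVneq y1 x1) => [E1|_]; case: (eqVneq y2 x1) => [E2|_] /= H1; try by lia.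
  rewrite E1 (eq_sym x1) (negbTE n12); case: (eqVneq y2 x2) => [->|_] /= H2; last by lia.
  by left; split=> //; lia.
rewrite E2 (eq_sym x1 x2) (negbTE n12); case: (eqVneq y1 x2) => [->|_] /= H2; last by lia.
by right; split=> //; lia.
Qed.

End independence.

(** * Upper bound for the Fourier dimension *)

Section trig_sums.
Variable R : realType.
Implicit Types x b : R.

(** Induction: with [y = x + 1], the condition [b <= 1/2] gives [(y / x)^b <= sqrt (1 + 1/x) <= 1 +
    1/(2x)], and then [2x (1 + 1/(2x)) + 1 = 2y] closes the step. *)
Lemma sum_powR_le (K : nat) b : 0 <= b <= 1 / 2 ->
  \sum_(h < K) h.+1%:R `^ (- b) <= 2 * K%:R `^ (1 - b).
Proof.
move=> /andP[b0 b2]; elim: K => [|K IH].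
  by rewrite big_ord0 mulr_ge0 // powR_ge0.
rewrite big_ord_recr /=.
have pB n : n.+1%:R `^ (1 - b) = n.+1%:R * n.+1%:R `^ (- b) :> R.
  by rewrite powRD ?powRr1 //; apply/implyP => _; rewrite pnatr_eq0.
case: K IH => [_|K IH].
  by rewrite big_ord0 add0r !powR1; lra.
apply: le_trans (lerD IH (lexx _)) _; rewrite !pB.
set x := K.+1%:R; set y := K.+2%:R.
have x0 : 0 < x by rewrite ltr0n.
have yx : y = x + 1 by rewrite natr1.
have y0 : 0 < y by rewrite ltr0n.
have xy : x `^ (- b) <= y `^ (- b) * (1 + 1 / (2 * x)).
  have yxE : y = x * (1 + 1 / x) by rewrite yx; field; rewrite gt_eqF.
  have i0 : 0 <= 1 / x by rewrite divr_ge0 // ltW.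
  have z1 : 1 <= 1 + 1 / x by rewrite lerDl.
  have E : x `^ (- b) = y `^ (- b) * (1 + 1 / x) `^ b.
    rewrite {1}yxE powRM ?(ltW x0) ?(le_trans _ z1) // -mulrA -powRD.
      by rewrite addNr powRr0 mulr1.
    by apply/implyP => _; rewrite gt_eqF // (lt_le_trans _ z1).
  rewrite E; apply: ler_wpM2l; first exact: powR_ge0.
  apply: le_trans (_ : (1 + 1 / x) `^ (2^-1) <= _); first by rewrite ler_powR //; lra.
  rewrite powR12_sqrt ?(le_trans _ z1) //.
  have h0 : 0 <= 1 + 1 / (2 * x) by rewrite addr_ge0 // divr_ge0 // mulr_ge0 // ltW.
  rewrite -(ger0_norm h0) -sqrtr_sqr; apply: ler_wsqrtr.
  have -> : (1 + 1 / (2 * x)) ^+ 2 = (1 + 1 / x) + (1 / (2 * x)) ^+ 2.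
    by field; rewrite gt_eqF.
  by rewrite lerDl sqr_ge0.
have h1 : 2 * (x * x `^ (- b)) <= 2 * (x * (y `^ (- b) * (1 + 1 / (2 * x)))).
  by rewrite ler_pM2l // ler_pM2l.
apply: le_trans (lerD h1 (lexx _)) _; apply: le_of_eq.
by rewrite yx; field; rewrite gt_eqF.
Qed.

(** Every positive gap from [j] occurs at most twice, once on each side. *)
Lemma sum_gap_le (phi : nat -> R) (K j : nat) : (forall h, 0 <= phi h) -> (j < K)%N ->
  \sum_(k < K) phi (gap j k) <= phi 0%N + 2 * \sum_(h < K) phi h.+1.
Proof.
move=> p0 jK.
have widen m : (m <= K)%N -> \sum_(h < m) phi h.+1 <= \sum_(h < K) phi h.+1.
  move=> mK; rewrite -!(big_mkord xpredT (fun h => phi h.+1)) [X in _ <= X](big_cat_nat (n := m)) //=.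
  by rewrite lerDl sumr_ge0.
have left m : \sum_(k < m) phi (m - k)%N = \sum_(h < m) phi h.+1.
  elim: m => [|m IH]; first by rewrite !big_ord0.
  rewrite big_ord_recl big_ord_recr /= subn0 addrC; congr (_ + _).
  by rewrite -IH; apply: eq_bigr => k _; rewrite /bump /= add1n subSS.
rewrite -(big_mkord xpredT (fun k => phi (gap j k))) (big_cat_nat (n := j)) //=; last exact: ltnW.
have -> : \sum_(j <= k < K) phi (gap j k) = \sum_(0 <= i < K - j) phi (gap j (i + j)).
  by rewrite -{1}[j]add0n big_addn.
have -> : (K - j = (K - j).-1.+1)%N by rewrite prednK // subn_gt0.
rewrite big_nat_recl // add0n.
have -> : gap j j = 0%N by rewrite /gap subnn.
have E1 : \sum_(0 <= k < j) phi (gap j k) = \sum_(h < j) phi h.+1.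
  rewrite -left -(big_mkord xpredT (fun k => phi (j - k)%N)).
  by apply: eq_big_nat => k /andP[_ kj]; rewrite /gap (eqP (ltnW kj)) addn0.
have E2 : \sum_(0 <= i < (K - j).-1) phi (gap j (i.+1 + j)) = \sum_(h < (K - j).-1) phi h.+1.
  rewrite -(big_mkord xpredT (fun h => phi h.+1)); apply: eq_bigr => i _; congr phi.
  by rewrite /gap addnK; lia.
rewrite E1 E2.
have le_r : ((K - j).-1 <= K)%N by apply: leq_trans (leq_pred _) (leq_subr _ _).
have := widen j (ltnW jK); have := widen _ le_r; lra.
Qed.

(* [|sum_(k < K) exp (i k y)| ^ 2], i.e. [K] times the Fejer kernel *)
Definition fejer (K : nat) (y : R) : R :=
  \sum_(j < K) \sum_(k < K) cos (j%:R * y - k%:R * y).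

Lemma fejerE K y :
  fejer K y = (\sum_(j < K) cos (j%:R * y)) ^+ 2 + (\sum_(j < K) sin (j%:R * y)) ^+ 2.
Proof.
rewrite /fejer !expr2 !big_distrlr -big_split; apply: eq_bigr => j _.
by rewrite -big_split; apply: eq_bigr => k _; rewrite cosB.
Qed.

Lemma fejer_ge0 K y : 0 <= fejer K y.
Proof. by rewrite fejerE addr_ge0 ?sqr_ge0. Qed.

(** All phases [j * (2 * pi * q * x)] are within [1/2] of multiples of [2 * pi], so each cosine is
    at least [1/2] and their sum at least [K / 2]. *)
Lemma fejer_near K x (p q : nat) : (0 < q)%N ->
  4 * pi * K%:R * q%:R * `|x - p%:R / q%:R| <= 1 ->
  K%:R ^+ 2 / 4 <= fejer K (2 * pi * q%:R * x).
Proof.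
move=> q0 near; rewrite fejerE.
have q0R : 0 < q%:R :> R by rewrite ltr0n.
have c2 (j : 'I_K) : 1 / 2 <= cos (j%:R * (2 * pi * q%:R * x)).
  set y := j%:R * (2 * pi * q%:R * (x - p%:R / q%:R)).
  have -> : j%:R * (2 * pi * q%:R * x) = y + (pi *+ 2) *+ (j * p).
    have -> : (pi *+ 2) *+ (j * p) = 2 * pi * j%:R * p%:R :> R.
      by rewrite -mulrnA -[LHS]mulr_natr !natrM; ring.
    by rewrite /y; move: (pi : R) => P; field; rewrite gt_eqF.
  rewrite (periodicn (@cosD2pi R)).
  have y2 : `|y| <= 1 / 2.
    rewrite /y !normrM (@ger0_norm _ 2) // (ger0_norm (pi_ge0 R)) !normr_nat.
    have jK : j%:R <= K%:R :> R by rewrite ler_nat ltnW.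
    have n0 : 0 <= pi * q%:R * `|x - p%:R / q%:R| by rewrite !mulr_ge0 ?pi_ge0.
    have := ler_wpM2r n0 jK; lra.
  have := cos_lip y 0; rewrite cos0 subr0 ler_norml; lra.
have : K%:R / 2 <= \sum_(j < K) cos (j%:R * (2 * pi * q%:R * x)).
  apply: le_trans (_ : \sum_(j < K) (1 / 2) <= _); last by apply: ler_sum => j _; exact: c2.
  by rewrite sumr_const card_ord -[_ *+ _]mulr_natr; apply: le_of_eq; field.
move=> h; have h0 : 0 <= K%:R / 2 :> R by rewrite divr_ge0.
have h2 : (K%:R / 2) ^+ 2 <= (\sum_(j < K) cos (j%:R * (2 * pi * q%:R * x))) ^+ 2.
  by rewrite ler_sqr ?nnegrE // (le_trans h0).
apply: le_trans (_ : (K%:R / 2) ^+ 2 + 0 <= _).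
  by apply: le_of_eq; field.
by apply: lerD => //; exact: sqr_ge0.
Qed.

End trig_sums.

Section bounded_integrals.
Variables (R : realType) (mu : probability (measurableTypeR R) R).

Definition bounded_measurable (f : R -> R) :=
  measurable_fun setT (f : measurableTypeR R -> R) /\ exists B : R, forall x, `|f x| <= B.

Lemma bounded_measurable_sum (I : Type) (r : seq I) (f : I -> R -> R) :
  (forall i, bounded_measurable (f i)) -> bounded_measurable (fun x => \sum_(i <- r) f i x).
Proof.
move=> hf; elim: r => [|i r [mr [B hB]]].
  split; last by exists 0 => x; rewrite big_nil normr0.
  by under eq_fun do rewrite big_nil; exact: measurable_cst.
have [mi [Bi hBi]] := hf i; split.
  by under eq_fun do rewrite big_cons; exact: measurable_funD.
by exists (Bi + B) => x; rewrite big_cons; apply: le_trans (ler_normD _ _) _; exact: lerD.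
Qed.

Lemma bounded_measurable_integrable f (D : set (measurableTypeR R)) :
  measurable D -> bounded_measurable f -> mu.-integrable D (EFin \o f).
Proof. by move=> mD [mf [B hB]]; exact: bounded_integrable mD mf hB. Qed.

Lemma Rintegral_sum_bounded (I : Type) (r : seq I) (f : I -> R -> R) :
  (forall i, bounded_measurable (f i)) ->
  \int[mu]_(x in setT) (\sum_(i <- r) f i x) = \sum_(i <- r) \int[mu]_(x in setT) f i x.
Proof.
move=> hf; elim: r => [|i r IH].
  under eq_Rintegral do rewrite big_nil.
  by rewrite big_nil Rintegral_cst // mul0r.
under eq_Rintegral do rewrite big_cons.
rewrite big_cons -IH RintegralD //; apply: bounded_measurable_integrable => //.
exact: bounded_measurable_sum.
Qed.

Lemma Rintegral_ge_on (f : R -> R) (E : set (measurableTypeR R)) (c : R) :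
  measurable E -> mu E = 1%E -> bounded_measurable f -> (forall x, 0 <= f x) ->
  (forall x, E x -> c <= f x) -> c <= \int[mu]_(x in setT) f x.
Proof.
move=> mE E1 bf f0 fc.
rewrite -(setUv E) Rintegral_setU //; last 3 first.
- exact: measurableC.
- by rewrite setUv; exact: bounded_measurable_integrable.
- by apply/disj_setPS => x [].
rewrite -[c]addr0; apply: lerD; last by apply: Rintegral_ge0.
have -> : c = \int[mu]_(x in E) c.
  rewrite Rintegral_cst // -[LHS]mulr1; congr (_ * _); exact: (esym (congr1 fine E1)).
apply: le_Rintegral => //; last exact: bounded_measurable_integrable.
by apply: bounded_measurable_integrable => //; split=> //; exists `|c|.
Qed.

Lemma bounded_measurable_cos (xi th : R) : bounded_measurable (fun x : R => cos (xi * x + th)).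
Proof. by split; [exact: measurable_cos_affine | exists 1 => x; exact: cos_max]. Qed.

Variables (C b : R).
Hypothesis C0 : 0 < C.
Hypothesis b01 : 0 <= b <= 1 / 2.
Hypothesis decay : forall eta, 0 < eta ->
  \int[mu]_(x in setT) cos (2 * pi * eta * x + 0) <= C * eta `^ (- b).

Lemma bounded_measurable_fejer K (y : R) : bounded_measurable (fun x => fejer K (y * x)).
Proof.
apply: bounded_measurable_sum => j; apply: bounded_measurable_sum => k.
have -> : (fun x : R => cos (j%:R * (y * x) - k%:R * (y * x))) =
    (fun x : R => cos ((j%:R * y - k%:R * y) * x + 0)).
  by apply/funext => x; congr cos; ring.
exact: bounded_measurable_cos.
Qed.

(** The diagonal terms integrate to [1]; the others are Fourier coefficients at [q] times the gap.
    The [4] is the product of the factors [2] from [sum_gap_le] and [sum_powR_le]. *)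
Lemma fejer_integral_le (K q : nat) : (0 < q)%N ->
  \int[mu]_(x in setT) fejer K (2 * pi * q%:R * x) <=
    K%:R * (1 + 4 * C * (q%:R `^ (- b) * K%:R `^ (1 - b))).
Proof.
move=> q0; have q0R : 0 < q%:R :> R by rewrite ltr0n.
set A := _ `^ (- b) * _.
have bc (j k : 'I_K) : bounded_measurable
    (fun x : R => cos (j%:R * (2 * pi * q%:R * x) - k%:R * (2 * pi * q%:R * x))).
  have -> : (fun x : R => cos (j%:R * (2 * pi * q%:R * x) - k%:R * (2 * pi * q%:R * x))) =
    (fun x : R => cos ((j%:R * (2 * pi * q%:R) - k%:R * (2 * pi * q%:R)) * x + 0)).
    by apply/funext => x; congr cos; ring.
  exact: bounded_measurable_cos.
rewrite /fejer Rintegral_sum_bounded; last by move=> j; exact: bounded_measurable_sum.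
pose phi h := if h is h'.+1 then C * (q%:R * h%:R) `^ (- b) else 1 : R.
have phi0 h : 0 <= phi h by case: h => [|h] //=; rewrite mulr_ge0 ?powR_ge0 ?ltW.
apply: le_trans (_ : \sum_(j < K) (1 + 4 * C * A) <= _); last first.
  by rewrite sumr_const card_ord -[_ *+ _]mulr_natr mulrC.
apply: ler_sum => j _; rewrite Rintegral_sum_bounded //.
apply: le_trans (_ : \sum_(k < K) phi (gap j k) <= _).
  apply: ler_sum => k _.
  have -> : \int[mu]_(x in setT) cos (j%:R * (2 * pi * q%:R * x) - k%:R * (2 * pi * q%:R * x)) =
      \int[mu]_(x in setT) cos (2 * pi * (q%:R * (gap j k)%:R) * x + 0).
    apply: eq_Rintegral => x _.
    have [jk|kj] := leqP j k.
      rewrite /gap (eqP jk) add0n natrB // -cosN; congr cos; ring.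
    by rewrite /gap (eqP (ltnW kj)) addn0 natrB ?(ltnW kj) //; congr cos; ring.
  case: (gap j k) => [|h] /=; last by apply: decay; rewrite mulr_gt0 // ltr0n.
  under eq_Rintegral do rewrite mulr0 mulr0 mul0r addr0 cos0.
  rewrite Rintegral_cst // mul1r; apply: le_of_eq.
  exact: (congr1 fine (probability_setT mu)).
apply: le_trans (sum_gap_le phi0 (ltn_ord j)) _.
rewrite lerD2l /phi.
under eq_bigr do rewrite powRM //.
rewrite -mulr_sumr -mulr_sumr.
have := sum_powR_le K b01 => H.
have := ler_wpM2l (powR_ge0 q%:R (- b)) H => {}H.
have := ler_wpM2l (ltW C0) H => {}H.
have -> : 4 * C * A = 2 * (C * (q%:R `^ (- b) * (2 * K%:R `^ (1 - b)))) by rewrite /A; ring.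
by rewrite ler_pM2l.
Qed.

End bounded_integrals.

(** * Testing measures on the limit set against Fejer kernels *)

Section upper.
Variables (R : realType) (M : R) (N : nat -> seq (node R)) (l : nat -> R).
Hypothesis M8 : 8 <= M.
Hypothesis tow : tower M N l.

Let M1 : 1 <= M. Proof. by move: M8; lra. Qed.

(** On the set, the sum of the kernels over all admissible [q] is at least [K^2 / 4], while decay
    bounds its integral. Comparison gives [1/4 <= (1 + 4C) / Z] with [Z >= n], which bounds the
    stages [n] large enough for the last hypothesis. *)
Lemma tower_mass_le (mu : probability (measurableTypeR R) R) (C b : R) n :
  mu (tower_set N l) = 1%E -> 0 < C -> 0 <= b <= 1 / 2 ->
  (forall eta, 0 < eta ->
    \int[mu]_(x in setT) cos (2 * pi * eta * x + 0) <= C * eta `^ (- b)) ->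
  (1 + b) <= (4 * b - 1) * (n + 5)%:R ->
  n%:R <= 4 * (1 + 4 * C).
Proof.
move=> mE C0 b01 decay bn.
have [_ [_ _ [t nt [l'E hN _]]]] := tow n.
set s := (n + 5)%N in bn l'E hN.
have /andP[b0 b2] := b01.
set W := (2 ^ (t * (n + 4)))%N in hN; set Y := (2 ^ (t * s))%N in l'E hN.
pose Z : R := (2 ^ t)%:R.
have arith m : (0 < m)%N -> (m.-1 + m * 3)%N = (m * 4).-1.
  by clear; case: m => // m _; rewrite mulSn mulSn /= addnCA; lia.
have s0 : (0 < s)%N by rewrite /s addnS.
have s1 : (n + 4 = s.-1)%N by rewrite /s [(n + 5)%N]addnS.
have WE : W%:R = Z ^+ s.-1 :> R by rewrite /W /Z -natrX -expnM s1.
have YE : Y%:R = Z ^+ s :> R by rewrite /Y /Z -natrX -expnM.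
have nZ : n%:R <= Z.
  rewrite ler_nat; apply: leq_trans nt _; exact/ltnW/ltn_expl.
have Z1 : 1 <= Z by rewrite ler1n expn_gt0.
have W0 : (0 < W)%N by rewrite expn_gt0.
have Y0 : (0 < Y)%N by rewrite expn_gt0.
clearbody Z W Y.
have Z0 : 0 < Z by apply: lt_le_trans Z1.
have YR : 0 < Y%:R :> R by rewrite ltr0n.
have WR : 0 < W%:R :> R by rewrite ltr0n.
(* As [l n.+1 = 1 / (M * Y^4)], for this order the condition of [fejer_near] reduces to
   [2 * pi <= M], whence the requirement [8 <= M]. *)
pose K := (Y ^ 3)%N.
have KE : K%:R = Y%:R ^+ 3 :> R by rewrite natrX.
have K0 : 0 < K%:R :> R by rewrite KE exprn_gt0.
(* All integers of [(W, Y]], prime or not: counting them by [Y] is precise enough. *)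
pose Qs := [seq q <- iota 1 Y | (W < q)%N].
have M0 : 0 < M by apply: lt_le_trans M1.
have lower : K%:R ^+ 2 / 4 <= \int[mu]_(x in setT) \sum_(q <- Qs) fejer K (2 * pi * q%:R * x).
  apply: (Rintegral_ge_on (measurable_cover _ _) mE).
  - by apply: bounded_measurable_sum => q; exact: bounded_measurable_fejer.
  - by move=> x; apply: sumr_ge0 => q _; exact: fejer_ge0.
  move=> x /(_ n.+1)[_ /mapP[a aN ->] /= xa].
  have [pq /andP[Wq qY] _] := hN _ aN; have q0 := prime_gt0 pq.
  have qQ : a.2.2 \in Qs by rewrite mem_filter Wq mem_iota q0 add1n ltnS.
  apply: le_trans (_ : fejer K (2 * pi * a.2.2%:R * x) <= _); last first.
    rewrite (bigD1_seq _ qQ) ?filter_uniq ?iota_uniq //= lerDl.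
    by apply: sumr_ge0 => q _; exact: fejer_ge0.
  apply: (@fejer_near _ _ _ a.2.1) => //.
  apply: le_trans (_ : 4 * pi * K%:R * Y%:R * (l n.+1 / 2) <= _).
    have p0 := pi_ge0 R.
    apply: ler_pM => //; first by rewrite !mulr_ge0.
    by rewrite ler_wpM2l ?mulr_ge0 // ler_nat.
  rewrite l'E KE.
  have -> : 4 * pi * Y%:R ^+ 3 * Y%:R * ((M * Y%:R ^+ 4)^-1 / 2) = 2 * pi / M.
    by move: (pi : R) => P; field; rewrite !gt_eqF.
  by rewrite ler_pdivrMr // mul1r; have := pihalf_lt2 R; move: M8; lra.
have upper : \int[mu]_(x in setT) \sum_(q <- Qs) fejer K (2 * pi * q%:R * x) <=
    Y%:R * (K%:R * (1 + 4 * C * (W%:R `^ (- b) * K%:R `^ (1 - b)))).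
  rewrite Rintegral_sum_bounded; last by move=> q; exact: bounded_measurable_fejer.
  apply: le_trans (_ : \sum_(q <- Qs) (K%:R * (1 + 4 * C * (W%:R `^ (- b) * K%:R `^ (1 - b)))) <= _).
    rewrite big_seq [X in _ <= X]big_seq; apply: ler_sum => q.
    rewrite mem_filter mem_iota => /andP[Wq /andP[q0 _]].
    apply: le_trans (fejer_integral_le C0 b01 decay K q0) _.
    rewrite ler_pM2l // lerD2l ler_pM2l ?mulr_gt0 // ler_wpM2r ?powR_ge0 //.
    rewrite !powRN lef_pV2 ?posrE ?powR_gt0 ?ltr0n // ge0_ler_powR ?nnegrE ?ler_nat //.
    exact: ltnW.
  rewrite big_const_seq count_predT iter_addr_0 -[_ *+ _]mulr_natl ler_wpM2r //.
    by rewrite mulr_ge0 ?addr_ge0 ?mulr_ge0 ?powR_ge0 // ltW.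
  by rewrite ler_nat /Qs size_filter (leq_trans (count_size _ _)) // size_iota.
have := le_trans lower upper.
have -> : K%:R `^ (1 - b) = K%:R * K%:R `^ (- b) :> R.
  by rewrite powRD ?powRr1 ?(ltW K0) //; apply/implyP => _; rewrite gt_eqF.
(* The left side is [Z] to the power [s - b (4s - 1)], and this exponent is at most [-1] exactly by
   [bn]. *)
have WK : Y%:R * (W%:R `^ (- b) * K%:R `^ (- b)) <= Z^-1.
  rewrite -powRM ?(ltW WR) ?(ltW K0) // KE WE YE -exprM -exprD -!powR_mulrn ?(ltW Z0) //.
  rewrite -powRrM -powRD; last by apply/implyP => _; rewrite gt_eqF.
  rewrite -powR_inv1 ?(ltW Z0) // ler_powR //.
  have -> : (s.-1 + s * 3)%N = (s * 4).-1 by exact: arith.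
  have sp : (0 < s * 4)%N by rewrite muln_gt0 s0.
  rewrite -subn1 natrB // natrM -subr_ge0.
  have -> : -1 - (s%:R + (s%:R * 4 - 1) * - b) = (4 * b - 1) * s%:R - (1 + b) :> R by ring.
  by rewrite subr_ge0.
have YK : Y%:R / K%:R <= Z^-1.
  rewrite KE YE; have -> : Z ^+ s / (Z ^+ s) ^+ 3 = (Z ^+ (s * 2))^-1.
    by rewrite exprM; field; rewrite gt_eqF // exprn_gt0.
  rewrite lef_pV2 ?posrE ?exprn_gt0 // -[X in X <= _]expr1 ler_weXn2l //.
  by rewrite muln_gt0 s0.
move=> H.
have H2 : 1 / 4 <= Y%:R / K%:R + 4 * C * (Y%:R * (W%:R `^ (- b) * K%:R `^ (- b))).
  rewrite -(ler_pM2l (exprn_gt0 2 K0)); apply: le_trans (_ : K%:R ^+ 2 / 4 <= _).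
    by apply: le_of_eq; field.
  apply: le_trans H _; apply: le_of_eq; field.
  by rewrite gt_eqF.
have H3 : 1 / 4 <= (1 + 4 * C) * Z^-1.
  apply: le_trans H2 _; rewrite [X in _ <= X]mulrDl [X in _ <= X + _]mul1r; apply: lerD => //.
  by rewrite ler_pM2l // mulr_gt0.
apply: le_trans nZ _.
by move: H3; rewrite ler_pdivlMr //; lra.
Qed.

Lemma normc_ge_Re (x y : R) : `|x| <= ComplexField.Normc.normc (x +i* y)%C.
Proof.
rewrite /ComplexField.Normc.normc -sqrtr_sqr; apply: ler_wsqrtr.
by rewrite lerDl sqr_ge0.
Qed.

Lemma tower_dim_le (beta : R) : 0 <= beta <= 1 -> fourier_decay (tower_set N l) beta -> beta <= 1 / 2.
Proof.
move=> /andP[b0 b1] [mu [mE [C [C0 hC]]]]; rewrite leNgt; apply/negP => b2.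
set b := beta / 2; have b01 : 0 <= b <= 1 / 2 by rewrite /b; apply/andP; split; lra.
have d0 : 0 < 4 * b - 1 by rewrite /b; lra.
have decay eta : 0 < eta ->
    \int[mu]_(x in setT) cos (2 * pi * eta * x + 0) <= C * eta `^ (- b).
  move=> e0; have := hC eta; rewrite (gtr0_norm e0) -/b => H.
  apply: le_trans (le_trans (le_trans _ H) _); last first.
  - rewrite ler_pM2l // !powRN lef_pV2 ?posrE ?powR_gt0 ?addr_gt0 //.
    have /andP[bb _] := b01.
    by rewrite ge0_ler_powR ?nnegrE ?addr_ge0 ?(ltW e0) // lerDr.
  - exact: normc_ge_Re.
  apply: le_trans (ler_norm _); apply: le_of_eq; apply: eq_Rintegral => x _ /=.
  by rewrite cosN addr0; congr cos; ring.
(* Beyond the first term the exponent condition of [tower_mass_le] holds, as [4 * b > 1]; the second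
   term contradicts its conclusion. *)
set n := (Num.truncn ((1 + b) / (4 * b - 1)) + (Num.truncn (4 * (1 + 4 * C))).+1)%N.
have k1 : 0 <= (1 + b) / (4 * b - 1).
  by have /andP[? _] := b01; rewrite divr_ge0 ?(ltW d0) //; lra.
have k2 : 0 <= 4 * (1 + 4 * C) by lra.
have /andP[_ t1] := @truncn_itv R _ k1.
have /andP[_ t2] := @truncn_itv R _ k2.
have bn : 1 + b <= (4 * b - 1) * (n + 5)%:R.
  rewrite mulrC -ler_pdivrMr //; apply: le_trans (ltW t1) _.
  by rewrite ler_nat /n -addnA -[X in (X <= _)%N]addn1 leq_add2l.
have := tower_mass_le mE C0 b01 decay bn; apply/negP; rewrite -ltNge.
by apply: lt_le_trans t2 _; rewrite ler_nat leq_addl.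
Qed.

End upper.

Theorem theorem2 (R : realType) (a b c d : nat)
    (ha : (0 < a)%N) (hb : (0 < b)%N) (hc : (0 < c)%N) (hd : (0 < d)%N)
    (habcd : (a + b = c + d)%N) :
  exists E : set (measurableTypeR R),
    [/\ measurable E,
        E `<=` `[0, 1]%classic,
        fourier_dim E = 1 / 2 &
        forall x1 x2 y1 y2 : R, E x1 -> E x2 -> E y1 -> E y2 ->
          a%:R * x1 + b%:R * x2 = c%:R * y1 + d%:R * y2 ->
          trivial_solution a b c d x1 x2 y1 y2].
Proof.
(* The [8] serves the upper bound on the dimension, the sum of the coefficients the exclusion of
   solutions. *)
set M : R := 8 + (a + b + c + d)%:R.
have n0 : 0 <= (a + b + c + d)%:R :> R by [].
have M8 : 8 <= M by rewrite lerDl.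
have M1 : 1 <= M by rewrite /M; lra.
have [N [l tow]] := tower_exists M1.
exists (tower_set N l); split.
- exact: measurable_cover.
- move=> x /(_ 0%N)[_ /mapP[v vN ->] /= xv].
  have [[_ _ _ /(_ v vN) vb] _] := tow 0%N.
  by rewrite in_itv /=; move: xv vb; rewrite ler_norml; lra.
- have ub : ubound [set beta | 0 <= beta <= 1 /\ fourier_decay (tower_set N l) beta] (1 / 2).
    by move=> beta [b01 bd]; exact: tower_dim_le M8 tow _ b01 bd.
  have low (beta : R) : 0 <= beta < 1 / 2 -> beta <= fourier_dim (tower_set N l).
    move=> b02; apply: ub_le_sup; first by exists (1 / 2).
    by split; [apply/andP; split; case/andP: b02; lra | exact: tower_fourier_decay M1 tow _ b02].
  apply/eqP; rewrite eq_le; apply/andP; split.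
    apply: ge_sup => //; exists 0; split; first by rewrite lexx ler01.
    by apply: (tower_fourier_decay M1 tow); rewrite lexx divr_gt0.
  (* Otherwise the midpoint between the dimension and [1/2] would be an admissible exponent above
     the supremum. *)
  rewrite leNgt; apply/negP => h.
  have h0 : 0 <= fourier_dim (tower_set N l) by apply: low; rewrite lexx divr_gt0.
  have := low ((fourier_dim (tower_set N l) + 1 / 2) / 2); lra.
move=> x1 x2 y1 y2 h1 h2 h3 h4.
by apply: (tower_no_solution M1 tow) => //; rewrite /M lerDr.
Qed.
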